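(* Let $d\ge1$ and let $\omega$ be a weight function such that $\omega(2t)=O(\omega(t))$ as $t\to\infty$ and the function $t\mapsto\omega(e^t)$ is convex. For an entire function $F$ on $\mathbb{C}^d$, if $$\limsup_{s\in\mathbb{C},\,|s|\to\infty}\frac{\log|F(su)|}{\omega(|s|)}<\infty\quad(\text{resp. }=0),\qquad\text{for each }u\in\mathbb{S}^{d-1},$$ then $$\limsup_{z\in\mathbb{C}^d,\,|z|\to\infty}\frac{\log|F(z)|}{\omega(|z|)}<\infty\quad(\text{resp. }=0).$$
   Context: A weight function is an unbounded non-decreasing function $\omega:[0,\infty)\to[0,\infty)$. $\mathbb{S}^{d-1}$ is the (real) unit sphere in $\mathbb{R}^d$, so that for $s\in\mathbb{C}$ and $u\in\mathbb{S}^{d-1}$, $su=(su_1,\dots,su_d)\in\mathbb{C}^d$. $|z|$ is the Euclidean norm on $\mathbb{C}^d$, and $\log 0=-\infty$. *)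

(* Defs.v *)
From HB Require Import structures.
From mathcomp Require Import all_boot all_order all_algebra.
From mathcomp Require Import all_classical all_reals all_analysis.
From mathcomp Require Import complex.

Set Implicit Arguments.
Unset Strict Implicit.
Unset Printing Implicit Defensive.

Import Order.TTheory GRing.Theory Num.Theory.
Import numFieldNormedType.Exports.

Local Open Scope classical_set_scope.
Local Open Scope ring_scope.

(* The library provides this structure only on the alias R[i]^o. *)
HB.instance Definition _ (R : realType) := NormedModule.copy R[i] R[i]^o.

(* Lets the Landau notations be used at +oo. *)
Canonical pinfty_filter_on (R : realType) :=
  FilterType (pinfty_nbhs R) _.

(* A function [0, +oo[ -> [0, +oo[ is represented by a total function R -> R
   of which only the values on `[0, +oo[ matter. *)
Definition weight_function (R : realType) (omega : R -> R) : Prop :=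
  [/\ {in `[0, +oo[, forall t, 0 <= omega t},
      {in `[0, +oo[ &, {homo omega : s t / s <= t}}
    & ~ has_ubound (omega @` `[0, +oo[)].

(* The norm of the library on R[i] takes its values in R[i], and the one on
   matrices is the sup norm. *)
Definition cabs (R : realType) (s : R[i]) : R := Normc.normc s.

Definition euclidean_norm (R : realType) (d : nat) (z : 'rV[R[i]]_d) : R :=
  Num.sqrt (\sum_(j < d) cabs (z ord0 j) ^+ 2).

Definition unit_sphere (R : realType) (d : nat) : set 'rV[R]_d :=
  [set u | Num.sqrt (\sum_(j < d) u ord0 j ^+ 2) = 1].

Definition cline (R : realType) (d : nat) (u : 'rV[R]_d) (s : R[i]) :
    'rV[R[i]]_d :=
  s *: map_mx (real_complex R) u.

(* Differentiability is over the scalar field R[i]. *)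
Definition entire (R : realType) (d : nat) (F : 'rV[R[i]]_d -> R[i]) : Prop :=
  forall z : 'rV[R[i]]_d, differentiable F z.

Definition at_infinity (R : realType) (T : Type) (N : T -> R) : set_system T :=
  filter_from [set: R] (fun M => [set z | M < N z]).

(* lne 0 = -oo.  Wherever omega vanishes the quotient takes a junk value; for a
   weight function this does not happen for large arguments. *)
Definition log_ratio (R : realType) (omega : R -> R) (w : R[i]) (r : R) :
    \bar R :=
  (lne (cabs w)%:E / (omega r)%:E)%E.

Definition limsup_line (R : realType) (d : nat) (omega : R -> R)
    (F : 'rV[R[i]]_d -> R[i]) (u : 'rV[R]_d) : \bar R :=
  limf_esup (fun s : R[i] => log_ratio omega (F (cline u s)) (cabs s))
    (at_infinity (@cabs R)).

Definition limsup_full (R : realType) (d : nat) (omega : R -> R)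
    (F : 'rV[R[i]]_d -> R[i]) : \bar R :=
  limf_esup
    (fun z : 'rV[R[i]]_d => log_ratio omega (F z) (euclidean_norm z))
    (at_infinity (@euclidean_norm R d)).

(* Main.v *)
From HB Require Import structures.
Require Import Defs.
From mathcomp Require Import all_boot all_order all_algebra.
From mathcomp Require Import all_classical all_reals all_analysis.
From mathcomp Require Import measurable_realfun complex.
From mathcomp Require Import ring lra zify.
Set Implicit Arguments.
Unset Strict Implicit.
Unset Printing Implicit Defensive.
Import Order.TTheory GRing.Theory Num.Theory.
Import numFieldNormedType.Exports.

Local Open Scope classical_set_scope.
Local Open Scope ring_scope.
Local Open Scope complex_scope.

(** Expand [F] into homogeneous polynomials, [F (s z) = sum_k P_k z * s ^ k].
    On the line through a real unit vector [u] the hypothesis says that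
    [|F (s u)| <= exp (n + lam * omega |s|)] for some [n] depending on [u] (and
    some [lam], which for a finite limsup also depends on [u]). By Cauchy's
    estimates [|P_k u| <= 2 exp (n + lam * omega r) / r ^ k] for all [k] and all
    [r > 0]: at each real point the whole family of the [P_k], with their
    weights, is bounded.

    The heart of the proof is to pass from pointwise bounds at real points to a
    uniform bound on the complex polydisc, losing only a factor [A ^ k] with [A]
    depending on nothing but the dimension ([pointwise_bound_poly] in one
    variable, [cube_to_polydisc] in several). In one variable, the closed sets
    where the [n]-th bound holds increase to [[0, 1]], so one of them, say [E],
    has measure above 1/2. Such a set contains [k + 1] points with gaps
    proportional to [1 / k] ([separated_points]), and Lagrange interpolation at
    them bounds a polynomial of degree [k] on the unit disc by [2 * 64 ^ k]
    times its bound on [E] ([lagrange_bound]). Several variables are treated one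
    coordinate at a time.

    Scaling back, [|P_k z| <= C (A |z| / r) ^ k exp (n + lam * omega r)], and with
    [r = 2 A |z|] the sum over [k] gives
    [|F z| <= C' exp (n + lam * omega (2 A |z|))] ([growth_transfer]). The
    doubling condition replaces [omega (2 A |z|)] by [L * omega |z|], with [L]
    independent of [lam]; letting [lam] tend to 0 settles the case of a zero
    limsup, in which the lower bound is read off on a single line.

    The properties of the [P_k] rest on one-variable Cauchy theory, obtained from
    mere differentiability. Goursat's theorem for rectangles, applied in the
    variable [log w], shows that the mean of a holomorphic function over a
    circle around 0 does not depend on the radius ([Jint_const], [mean_value]);
    Taylor's formula with remainder ([taylor_remainder]) and Cauchy's estimates
    ([tcoef_le]) follow. The [P_k] are polynomials along every complex line,
    being entire there with growth of order [k] ([hpart_poly]). *)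

Local Notation Re := (@complex.Re _).
Local Notation Im := (@complex.Im _).

(** * Modulus and continuity of complex functions *)

Section Basics.
Variable R : realType.
Implicit Types (z w : R[i]) (x y : R).

Lemma normC_cabs z : `|z| = (cabs z)%:C.
Proof. by case: z. Qed.

Lemma cabs_ge0 z : 0 <= cabs z.
Proof. by case: z => a b; apply: sqrtr_ge0. Qed.
Lemma cabs0 : cabs 0 = 0 :> R. Proof. exact: Normc.normc0. Qed.
Lemma cabs1 : cabs 1 = 1 :> R. Proof. exact: Normc.normc1. Qed.
Lemma cabsM z w : cabs (z * w) = cabs z * cabs w.
Proof. exact: Normc.normcM. Qed.
Lemma cabsV z : cabs z^-1 = (cabs z)^-1.
Proof. exact: Normc.normcV. Qed.
Lemma cabsX z n : cabs (z ^+ n) = cabs z ^+ n.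
Proof. by elim: n => [|n IH]; rewrite ?cabs1// !exprS cabsM IH. Qed.
Lemma cabsN z : cabs (- z) = cabs z.
Proof. exact: normcN. Qed.
Lemma cabsB z w : cabs (z - w) = cabs (w - z).
Proof. by rewrite -cabsN opprB. Qed.
Lemma cabsD z w : cabs (z + w) <= cabs z + cabs w.
Proof. exact: le_normcD. Qed.
Lemma cabs_eq0 z : (cabs z == 0) = (z == 0).
Proof.
by apply/eqP/eqP => [/Normc.eq0_normc//|->]; rewrite cabs0.
Qed.
Lemma cabs_gt0 z : (0 < cabs z) = (z != 0).
Proof. by rewrite lt_def cabs_ge0 andbT cabs_eq0. Qed.
Lemma cabs_real x : cabs x%:C = `|x|.
Proof. by rewrite /cabs /= expr0n addr0 sqrtr_sqr. Qed.
Lemma cabs_sum (I : Type) (r : seq I) (P : pred I) (f : I -> R[i]) :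
  cabs (\sum_(i <- r | P i) f i) <= \sum_(i <- r | P i) cabs (f i).
Proof.
elim/big_ind2: _ => //; first by rewrite cabs0.
by move=> a b c d h1 h2; apply: le_trans (cabsD _ _) _; apply: lerD.
Qed.
Lemma cabs_prod (I : Type) (r : seq I) (P : pred I) (f : I -> R[i]) :
  cabs (\prod_(i <- r | P i) f i) = \prod_(i <- r | P i) cabs (f i).
Proof. by elim/big_ind2: _ => [|a b c d <- <-|//]; rewrite ?cabs1// cabsM. Qed.
Lemma Re_le_cabs z : `|Re z| <= cabs z.
Proof.
case: z => a b; rewrite /cabs /= -sqrtr_sqr; apply: ler_wsqrtr.
by rewrite lerDl sqr_ge0.
Qed.
Lemma Im_le_cabs z : `|Im z| <= cabs z.
Proof.
case: z => a b; rewrite /cabs /= -sqrtr_sqr; apply: ler_wsqrtr.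
by rewrite lerDr sqr_ge0.
Qed.
Lemma cabs_le_ReIm z : cabs z <= `|Re z| + `|Im z|.
Proof.
have -> : z = (Re z)%:C + (Im z)%:C * 'i by case: z => a b; simpc.
apply: le_trans (cabsD _ _) _; rewrite cabsM !cabs_real.
by rewrite /cabs /= expr0n expr1n /= add0r sqrtr1 mulr1; case: z => a b; simpc.
Qed.

Lemma cabs_le0_eq z w : cabs (z - w) <= 0 -> z = w.
Proof.
by move=> h; apply/eqP; rewrite -subr_eq0 -cabs_eq0 eq_le h cabs_ge0.
Qed.

Lemma cabs_small_eq z w : (forall e : R, 0 < e -> cabs (z - w) <= e) -> z = w.
Proof.
by move=> H; apply/cabs_le0_eq/ler_addgt0Pr => e e0; rewrite add0r; exact: H.
Qed.

Lemma nbhsC z (A : set R[i]) :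
  nbhs z A <-> exists2 e : R, 0 < e & forall w, cabs (w - z) < e -> A w.
Proof.
split.
  move=> /nbhs_normP[/= e]; case: e => e e'; rewrite ltcE /= => /andP[/eqP -> e0] H.
  exists e => // w wz; apply: H; rewrite /ball_ /=.
  by rewrite normC_cabs; move: (ltcR (cabs (z - w)) e) => ->; rewrite cabsB.
move=> [e e0 H]; apply/nbhs_normP; exists e%:C; first by rewrite /= ltcE /= eqxx.
move=> w; rewrite /ball_ /= normC_cabs ltcR => ?; apply: H; by rewrite cabsB.
Qed.

Lemma continuousC (T : topologicalType) (f : T -> R[i]) t :
  {for t, continuous f} <->
  forall e : R, 0 < e -> \forall s \near t, cabs (f s - f t) < e.
Proof.
split=> [cf e e0|H].
  by apply: (cf [set w | cabs (w - f t) < e]); apply/nbhsC; exists e.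
move=> A /nbhsC[e e0 HA]; rewrite nbhs_simpl /=; near=> s.
by apply: HA; near: s; exact: H.
Unshelve. all: by end_near. Qed.

Lemma continuous_Re : continuous (@complex.Re R : R[i] -> R).
Proof.
move=> z; apply/(@cvgrPdist_lt _ _ _ _ (nbhs_filter z)) => e e0; apply/nbhsC;
  exists e => // w.
apply: le_lt_trans; rewrite cabsB.
by apply: le_trans (Re_le_cabs _); rewrite -[z]opprK; case: z w => a b [c d] /=;
  rewrite !opprK.
Qed.
Lemma continuous_Im : continuous (@complex.Im R : R[i] -> R).
Proof.
move=> z; apply/(@cvgrPdist_lt _ _ _ _ (nbhs_filter z)) => e e0; apply/nbhsC;
  exists e => // w.
apply: le_lt_trans; rewrite cabsB.
by apply: le_trans (Im_le_cabs _); rewrite -[z]opprK; case: z w => a b [c d] /=;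
  rewrite !opprK.
Qed.
Lemma continuous_cabs : continuous (@cabs R : R[i] -> R).
Proof.
move=> z; apply/(@cvgrPdist_lt _ _ _ _ (nbhs_filter z)) => e e0; apply/nbhsC;
  exists e => // w.
apply: le_lt_trans; rewrite ler_norml; apply/andP; split.
  have := cabsD (w - z) z; rewrite subrK; lra.
by have := cabsD (z - w) w; rewrite subrK (cabsB z); lra.
Qed.

Lemma continuous_complex (T : topologicalType) (f g : T -> R) t :
  {for t, continuous f} -> {for t, continuous g} ->
  {for t, continuous (fun s => f s +i* g s)}.
Proof.
move=> cf cg; apply/continuousC => e e0.
have e20 : 0 < e / 2 by rewrite divr_gt0.
have /cvgrPdist_lt/(_ _ e20) h1 := cf; have /cvgrPdist_lt/(_ _ e20) h2 := cg.
near=> s; apply: le_lt_trans (cabs_le_ReIm _) _ => /=.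
rewrite [ltRHS]splitr ltrD//; rewrite distrC; [near: s; exact: h1|near: s; exact: h2].
Unshelve. all: by end_near. Qed.

Lemma continuous_real_complex : continuous (real_complex R : R -> R[i]).
Proof.
move=> x; apply: (@continuous_complex _ (fun x => x) (fun=> 0)).
  exact: cvg_id.
exact: cvg_cst.
Qed.
Lemma continuousC_D (T : topologicalType) (f g : T -> R[i]) t :
  {for t, continuous f} -> {for t, continuous g} ->
  {for t, continuous (fun s => f s + g s)}.
Proof. move=> cf cg. exact: (@cvgD R[i] R[i] T (nbhs t) _ f g _ _ cf cg). Qed.
Lemma continuousC_M (T : topologicalType) (f g : T -> R[i]) t :
  {for t, continuous f} -> {for t, continuous g} ->
  {for t, continuous (fun s => f s * g s)}.
Proof. move=> cf cg. exact: (@cvgM R[i] T (nbhs t) _ f g _ _ cf cg). Qed.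
Lemma continuousC_N (T : topologicalType) (f : T -> R[i]) t :
  {for t, continuous f} -> {for t, continuous (fun s => - f s)}.
Proof. move=> cf. exact: (@cvgN _ R[i] T (nbhs t) _ f _ cf). Qed.
Lemma continuousC_V (T : topologicalType) (f : T -> R[i]) t : f t != 0 ->
  {for t, continuous f} -> {for t, continuous (fun s => (f s)^-1)}.
Proof. move=> f0 cf. exact: (@cvgV R[i] T (nbhs t) _ f _ f0 cf). Qed.
End Basics.

(** * Integrals of complex-valued functions of a real variable *)

Section PathIntegral.
Variable R : realType.
Implicit Types (z w : R[i]) (x y a b c : R) (f g : R -> R[i]).

Local Notation mu := (@lebesgue_measure R).

Lemma integrable_itv (f : R -> R) a b : continuous f ->
  mu.-integrable `[a, b] (EFin \o f).
Proof.
move=> cf; apply: continuous_compact_integrable; first exact: segment_compact.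
exact: continuous_subspaceT.
Qed.

Lemma Rintegral_itv_cst a b x : a <= b ->
  (\int[mu]_(t in `[a, b]) x = x * (b - a))%R.
Proof.
move=> ab; rewrite Rintegral_cst//; congr (_ * _).
have := lebesgue_measure_itv `[a, b]; rewrite /= lte_fin => ->.
by move: ab; rewrite le_eqVlt => /predU1P[->|->//]; rewrite ltxx subrr.
Qed.

Lemma Rintegral_cat (f : R -> R) a b c : continuous f -> a <= b -> b <= c ->
  \int[mu]_(t in `[a, c]) f t =
  \int[mu]_(t in `[a, b]) f t + \int[mu]_(t in `[b, c]) f t.
Proof.
move=> cf ab bc; apply/eqP; rewrite addrC -subr_eq.
rewrite Rintegral_itvB ?bnd_simp//; last exact: integrable_itv.
rewrite Rintegral_itv_obnd_cbnd//.
by apply: integrableS (@integrable_itv f b c cf) => //; apply: subset_itv_oc_cc.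
Qed.

Lemma normr_Rintegral_le (f : R -> R) a b M : continuous f -> a <= b ->
  (forall t, a <= t <= b -> `|f t| <= M) ->
  `|\int[mu]_(t in `[a, b]) f t| <= M * (b - a).
Proof.
move=> cf ab fM; rewrite -Rintegral_itv_cst//.
apply: le_trans (le_normr_Rintegral _ (integrable_itv a b cf)) _ => //.
have i1 : mu.-integrable `[a, b] (EFin \o (fun t => `|f t|)).
  apply: integrable_itv => t.
  by apply: continuous_comp; [exact: cf|exact: norm_continuous].
have i2 : mu.-integrable `[a, b] (EFin \o (fun=> M)).
  by apply: integrable_itv => t; exact: cvg_cst.
apply: (le_Rintegral _ i1 i2) => // t /=; rewrite in_itv /=; exact: fM.
Qed.

Definition cint f a b : R[i] :=
  (\int[mu]_(t in `[a, b]) Re (f t)) +i* (\int[mu]_(t in `[a, b]) Im (f t)).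

Lemma continuous_Re_comp f : continuous f -> continuous (fun t => Re (f t)).
Proof. by move=> cf t; apply: continuous_comp; [exact: cf|exact: continuous_Re]. Qed.
Lemma continuous_Im_comp f : continuous f -> continuous (fun t => Im (f t)).
Proof. by move=> cf t; apply: continuous_comp; [exact: cf|exact: continuous_Im]. Qed.

Lemma eq_cint f g a b : (forall t, a <= t <= b -> f t = g t) ->
  cint f a b = cint g a b.
Proof.
move=> fg; rewrite /cint; congr (_ +i* _); apply: eq_Rintegral => t;
  by rewrite inE /= in_itv /= => /fg ->.
Qed.

Lemma cintD f g a b : continuous f -> continuous g ->
  cint (fun t => f t + g t) a b = cint f a b + cint g a b.
Proof.
move=> cf cg; rewrite /cint [RHS]/GRing.add /=.
congr (_ +i* _); rewrite -RintegralD//;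
  do ?[by apply/integrable_itv/continuous_Re_comp|
       by apply/integrable_itv/continuous_Im_comp];
  by apply: eq_Rintegral => t _; case: (f t) (g t) => ? ? [].
Qed.

Lemma cintZ f w a b : continuous f ->
  cint (fun t => w * f t) a b = w * cint f a b.
Proof.
move=> cf; case: w => u v; rewrite /cint; simpc.
have cr := continuous_Re_comp cf; have ci := continuous_Im_comp cf.
have ir := integrable_itv a b cr; have ii := integrable_itv a b ci.
have iZ (h : R -> R) x : continuous h ->
    mu.-integrable `[a, b] (EFin \o (fun t => x * h t)).
  move=> ch; apply: integrable_itv => t.
  by apply: (@cvgM _ _ _ _ (fun=> x) h); [exact: cvg_cst|exact: ch].
congr (_ +i* _); rewrite -!RintegralZl//.
- rewrite -(RintegralB _ (iZ _ u cr) (iZ _ v ci))//.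
  by apply: eq_Rintegral => t _; case: (f t) => ? ?; simpc.
- rewrite -(RintegralD _ (iZ _ u ci) (iZ _ v cr))//.
  by apply: eq_Rintegral => t _; case: (f t) => ? ?; simpc.
Qed.

Lemma cint_cst z a b : a <= b -> cint (fun=> z) a b = z * (b - a)%:C.
Proof.
by move=> ab; rewrite /cint !Rintegral_itv_cst//; case: z => ? ?; simpc.
Qed.

Lemma cint_cat f a b c : continuous f -> a <= b -> b <= c ->
  cint f a c = cint f a b + cint f b c.
Proof.
move=> cf ab bc; rewrite /cint [RHS]/GRing.add /=; congr (_ +i* _);
apply: Rintegral_cat => //; [exact: continuous_Re_comp|exact: continuous_Im_comp].
Qed.

Lemma cabs_cint_le f a b M : continuous f -> a <= b ->
  (forall t, a <= t <= b -> cabs (f t) <= M) ->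
  cabs (cint f a b) <= 2 * M * (b - a).
Proof.
move=> cf ab fM; apply: le_trans (cabs_le_ReIm _) _ => /=.
rewrite -mulrA mulr_natl mulr2n lerD//; apply: normr_Rintegral_le => //.
- exact: continuous_Re_comp.
- by move=> t /fM; apply: le_trans; exact: Re_le_cabs.
- exact: continuous_Im_comp.
- by move=> t /fM; apply: le_trans; exact: Im_le_cabs.
Qed.

Lemma cintB f g a b : continuous f -> continuous g ->
  cint (fun t => f t - g t) a b = cint f a b - cint g a b.
Proof.
move=> cf cg.
have cm : continuous (fun t => -1 * g t).
  by move=> t; apply: (@continuousC_M _ _ (fun=> -1) g); [exact: cvg_cst|exact: cg].
rewrite (_ : (fun t => f t - g t) = (fun t => f t + -1 * g t)); last first.
  by apply/funext => t; rewrite mulN1r.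
by rewrite (cintD a b cf cm) (cintZ _ a b cg) mulN1r.
Qed.

Lemma cint_sum (I : Type) (r : seq I) (f : I -> R -> R[i]) a b :
  a <= b -> (forall i, continuous (f i)) ->
  cint (fun t => \sum_(i <- r) f i t) a b = \sum_(i <- r) cint (f i) a b.
Proof.
move=> ab cf; elim: r => [|i r IH].
  rewrite big_nil (_ : (fun t => _) = fun=> 0) ?cint_cst ?mul0r//.
  by apply/funext => t; rewrite big_nil.
rewrite big_cons -IH -cintD//.
  by congr cint; apply/funext => t; rewrite big_cons.
elim: r {IH} => [|j r IH] t.
  rewrite (_ : (fun t => _) = fun=> 0); first exact: cvg_cst.
  by apply/funext => s; rewrite big_nil.
rewrite (_ : (fun t => _) = fun t => f j t + \sum_(i <- r) f i t).
  by apply: (@continuousC_D _ _ (f j)); [exact: cf|exact: IH].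
by apply/funext => s; rewrite big_cons.
Qed.

(** By compactness of the segment of integration, the integrand is continuous
    in the parameter uniformly over the segment. *)
Lemma cint_param_continuous (T : topologicalType) (k : T * R -> R[i]) a b :
  a <= b -> continuous k -> continuous (fun x : T => cint (fun y => k (x, y)) a b).
Proof.
move=> ab ck x0.
have ckx (x : T) : continuous (fun y => k (x, y)).
  move=> y; apply: (@continuous_comp _ _ _ (fun y => (x, y)) k); last exact: ck.
  exact: (cvg_pair (@cvg_cst _ x _ (nbhs y) _) (@cvg_id _ (nbhs y))).
apply/continuousC => e e0.
pose d := e / (2 * (b - a) + 1).
have ba : 0 <= b - a by rewrite subr_ge0.
have d0 : 0 < d by rewrite divr_gt0//; lra.
have unif : \forall x \near x0, `[a, b]%classic `<=`
    [set y | cabs (k (x, y) - k (x0, y)) < d].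
  have /compact_near_coveringP/(_ _ (nbhs x0) (fun (x : T) y => cabs (k (x, y) - k (x0,
    y)) < d) _) := @segment_compact R a b.
  apply=> y _.
  have d20 : 0 < d / 2 by rewrite divr_gt0.
  have /continuousC/(_ _ d20) := ck (x0, y).
  move=> [[A B] [/= nA nB] AB].
  exists (B, A) => //= -[y' x'] /= [By' Ax'].
  have h1 := AB (x', y') (conj Ax' By').
  have h2 := AB (x0, y') (conj (nbhs_singleton nA) By').
  rewrite (_ : _ - _ = (k (x', y') - k (x0, y)) - (k (x0, y') - k (x0, y))).
    apply: le_lt_trans (cabsD _ _) _; rewrite cabsN [ltRHS]splitr.
    by apply: ltrD.
  by rewrite opprB addrA subrK.
near=> x; rewrite -cintB//; apply: (@le_lt_trans _ _ (2 * d * (b - a))).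
  apply: cabs_cint_le => //.
    by move=> t; apply: (@continuousC_D _ _ (fun y => k (x, y)));
      [exact: ckx|exact/continuousC_N/ckx].
  move=> t tab; apply/ltW; suff : `[a, b]%classic t by move: t {tab}; near: x;
    exact: unif.
  by rewrite /= in_itv.
rewrite mulrAC /d mulrA ltr_pdivrMr; last by lra.
by rewrite mulrC ltr_pM2l//; lra.
Unshelve. all: by end_near. Qed.

End PathIntegral.

(** * Goursat's theorem on rectangles *)

Section Goursat.
Variable R : realType.
Implicit Types (z w p : R[i]) (x y a b c d : R) (h : R[i] -> R[i]).

(** Cousin's lemma for rectangles, the compactness behind Goursat's proof: a
    rectangle without the property would contain ever smaller quarters without
    it, shrinking to a point. Only small rectangles containing the point need
    have the property; these are the ones that differentiability controls. *)
Lemma rectangle_bisection (P : R -> R -> R -> R -> Prop) a b c d :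
  a <= b -> c <= d ->
  (forall a b c d, a <= b -> c <= d ->
     let m := (a + b) / 2 in let n := (c + d) / 2 in
     P a m c n -> P m b c n -> P a m n d -> P m b n d -> P a b c d) ->
  (forall x y, a <= x <= b -> c <= y <= d -> exists2 e, 0 < e &
     forall a' b' c' d', a' <= x <= b' -> c' <= y <= d' ->
       (b' - a') + (d' - c') < e -> P a' b' c' d') ->
  P a b c d.
Proof.
move=> ab cd Psplit Ploc; apply: contrapT => nP.
pose bad (Q : R * R * R * R) := let: (a, b, c, d) := Q in
  [/\ a <= b, c <= d & ~ P a b c d].
pose sub (Q Q' : R * R * R * R) :=
  let: (a, b, c, d) := Q in let: (a', b', c', d') := Q' in
  [/\ a <= a', b' <= b, c <= c' & d' <= d] /\
  (b' - a' = (b - a) / 2 /\ d' - c' = (d - c) / 2).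
have /choice[f fP] : forall Q, exists Q', bad Q -> bad Q' /\ sub Q Q'.
  move=> [[[a1 b1] c1] d1].
  case: (pselect (bad (a1, b1, c1, d1))) => [|nb]; last by exists (a1, b1, c1, d1).
  move=> [ab1 cd1 nP1].
  pose m := (a1 + b1) / 2; pose n := (c1 + d1) / 2.
  have [m1 m2] := midf_le ab1; have [n1 n2] := midf_le cd1.
  have [p1|p1] := pselect (P a1 m c1 n); last first.
    exists (a1, m, c1, n) => _; split; first by [].
    split; first by split. by rewrite /m /n; split; lra.
  have [p2|p2] := pselect (P m b1 c1 n); last first.
    exists (m, b1, c1, n) => _; split; first by [].
    split; first by split. by rewrite /m /n; split; lra.
  have [p3|p3] := pselect (P a1 m n d1); last first.
    exists (a1, m, n, d1) => _; split; first by [].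
    split; first by split. by rewrite /m /n; split; lra.
  have [p4|p4] := pselect (P m b1 n d1); last first.
    exists (m, b1, n, d1) => _; split; first by [].
    split; first by split. by rewrite /m /n; split; lra.
  by exfalso; apply: nP1; apply: Psplit.
pose u n := iter n f (a, b, c, d).
have ubad n : bad (u n) by elim: n => [//|n IH] /=; case: (fP _ IH).
have usub n : sub (u n) (u n.+1) by case: (fP _ (ubad n)).
pose A n := (u n).1.1.1; pose B n := (u n).1.1.2.
pose C n := (u n).1.2; pose D n := (u n).2.
have uE n : u n = (A n, B n, C n, D n) by rewrite /A /B /C /D; case: (u n) => [[[]]].
have stp n : [/\ A n <= A n.+1, B n.+1 <= B n, C n <= C n.+1 & D n.+1 <= D n] /\
  (B n.+1 - A n.+1 = (B n - A n) / 2 /\ D n.+1 - C n.+1 = (D n - C n) / 2).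
  by have := usub n; rewrite !uE.
have bd n : [/\ A n <= B n, C n <= D n & ~ P (A n) (B n) (C n) (D n)].
  by have := ubad n; rewrite uE.
have nest (L U : nat -> R) : (forall n, L n <= L n.+1) ->
    (forall n, U n.+1 <= U n) -> (forall n, L n <= U n) ->
    exists x, forall n, L n <= x <= U n.
  move=> Ln Un LU.
  have homoL : {homo L : m n / (m <= n)%N >-> m <= n} by exact/nondecreasing_seqP.
  have homoU : {homo U : m n / (m <= n)%N >-> n <= m} by exact/nonincreasing_seqP.
  have LUmn m n : L m <= U n.
    apply: le_trans (homoL _ _ (leq_maxl m n)) _.
    exact: le_trans (LU _) (homoU _ _ (leq_maxr m n)).
  exists (sup (range L)) => n; apply/andP; split.
    by apply: ub_le_sup; [exists (U 0%N) => _ [m _ <-]|exists n].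
  by apply: ge_sup; [exists (L 0%N); exists 0%N|move=> _ [m _ <-]].
have [x xP] : exists x, forall n, A n <= x <= B n.
  by apply: nest => n; [case: (stp n) => [[]]|case: (stp n) => [[]]|case: (bd n)].
have [y yP] : exists y, forall n, C n <= y <= D n.
  by apply: nest => n; [case: (stp n) => [[]]|case: (stp n) => [[]]|case: (bd n)].
have [e e0 He] := Ploc x y (xP 0%N) (yP 0%N).
have len n : (B n - A n) + (D n - C n) = ((b - a) + (d - c)) / 2 ^+ n.
  elim: n => [|n IH]; first by rewrite expr0 divr1.
  case: (stp n) => _ [-> ->]; rewrite exprSr invfM mulrA -IH; lra.
have s0 : 0 <= b - a + (d - c) by lra.
have [n Hn] : exists n, ((b - a) + (d - c)) / 2 ^+ n < e.
  have [n Hn] : exists n : nat, ((b - a) + (d - c)) / e < n%:R.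
    exists (Num.bound (((b - a) + (d - c)) / e)).
    by apply: archi_boundP; rewrite divr_ge0// ltW.
  exists n; rewrite ltr_pdivrMr ?exprn_gt0//.
  rewrite ltr_pdivrMr// in Hn; apply: lt_le_trans Hn _; rewrite mulrC ler_pM2l//.
  by rewrite -natrX ler_nat ltnW// ltn_expl.
by case: (bd n) => _ _; apply; apply: He (xP n) (yP n) _; rewrite len.
Qed.

(** Differentiability with explicit moduli; see [complex_diffP]. *)
Definition complex_diff_at h p := exists l : R[i],
  forall e, 0 < e -> exists2 r : R, 0 < r & forall w, cabs (w - p) < r ->
    cabs (h w - h p - l * (w - p)) <= e * cabs (w - p).

(** The contour integral of [h] along the boundary of a rectangle, with
    opposite sides paired under one integral sign: an affine [h] then has
    constant integrands. *)
Definition rectint h a b c d : R[i] :=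
  cint (fun x => h (x +i* c) - h (x +i* d)) a b +
  'i * cint (fun y => h (b +i* y) - h (a +i* y)) c d.

Lemma continuous_hline h y : continuous h -> continuous (fun x => h (x +i* y)).
Proof.
move=> ch x; apply: (@continuous_comp _ _ _ (fun x => x +i* y) h); last exact: ch.
by apply: (@continuous_complex _ _ (fun x => x) (fun=> y));
  [exact: cvg_id|exact: cvg_cst].
Qed.
Lemma continuous_vline h x : continuous h -> continuous (fun y => h (x +i* y)).
Proof.
move=> ch y; apply: (@continuous_comp _ _ _ (fun y => x +i* y) h); last exact: ch.
by apply: (@continuous_complex _ _ (fun=> x) (fun y => y));
  [exact: cvg_cst|exact: cvg_id].
Qed.

Lemma rectint_split h a m b c n d : continuous h ->
  a <= m -> m <= b -> c <= n -> n <= d ->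
  rectint h a b c d = rectint h a m c n + rectint h m b c n +
                      rectint h a m n d + rectint h m b n d.
Proof.
move=> ch am mb cn nd; rewrite /rectint.
have hl y := @continuous_hline h y ch; have vl x := @continuous_vline h x ch.
rewrite (cintB _ _ (hl c) (hl d)) (cintB _ _ (vl b) (vl a)).
rewrite (cintB _ _ (hl c) (hl n)) (cintB _ _ (vl m) (vl a)).
rewrite (cintB a m (hl n) (hl d)) (cintB n d (vl m) (vl a)).
rewrite (cintB m b (hl c) (hl n)) (cintB c n (vl b) (vl m)).
rewrite (cintB m b (hl n) (hl d)) (cintB n d (vl b) (vl m)).
rewrite (cint_cat (hl c) am mb) (cint_cat (hl d) am mb).
rewrite (cint_cat (vl a) cn nd) (cint_cat (vl b) cn nd); ring.
Qed.

Lemma cabs_i : cabs 'i = 1 :> R.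
Proof. by rewrite /cabs /= expr0n expr1n /= add0r sqrtr1. Qed.

Lemma cabs_rect x y a b c d : a <= x <= b -> c <= y <= d ->
  forall x' y', a <= x' <= b -> c <= y' <= d ->
  cabs ((x' +i* y') - (x +i* y)) <= (b - a) + (d - c).
Proof.
move=> /andP[? ?] /andP[? ?] x' y' /andP[? ?] /andP[? ?].
apply: le_trans (cabs_le_ReIm _) _; apply: lerD => /=;
  rewrite ler_norml; apply/andP; split; lra.
Qed.

(** Goursat: the paired sides turn the affine part of [h] into two opposite
    constants, so only the error of differentiability contributes. *)
Lemma goursat h a b c d : continuous h -> a <= b -> c <= d ->
  (forall x y, a <= x <= b -> c <= y <= d -> complex_diff_at h (x +i* y)) ->
  rectint h a b c d = 0.
Proof.
move=> ch ab cd dh.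
have key e : 0 < e -> cabs (rectint h a b c d) <= e * ((b - a) + (d - c)) ^+ 2.
  move=> e0.
  apply: (@rectangle_bisection (fun a b c d =>
    cabs (rectint h a b c d) <= e * ((b - a) + (d - c)) ^+ 2)) => //.
    move=> a1 b1 c1 d1 ab1 cd1 m n h1 h2 h3 h4.
    have [m1 m2] := midf_le ab1; have [n1 n2] := midf_le cd1.
    rewrite (rectint_split ch m1 m2 n1 n2).
    apply: le_trans (cabsD _ _) _; apply: le_trans (lerD (le_trans (cabsD _ _)
      (lerD (le_trans (cabsD _ _) (lerD h1 h2)) h3)) h4) _.
    by rewrite /m /n le_eqVlt; apply/orP; left; apply/eqP; field.
  move=> x y xab ycd; have [l Hl] := dh x y xab ycd.
  have e40 : 0 < e / 4 by rewrite divr_gt0.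
  have [r r0 Hr] := Hl _ e40; exists r => //.
  move=> a1 b1 c1 d1 /[dup] xab1 /andP[ax xb] /[dup] ycd1 /andP[cy yd] sr.
  set s := b1 - a1 + (d1 - c1) in sr *.
  have ab1 := le_trans ax xb; have cd1 := le_trans cy yd.
  have s0 : 0 <= s by rewrite /s; lra.
  pose g w := h w - h (x +i* y) - l * (w - (x +i* y)).
  have gs x' y' : a1 <= x' <= b1 -> c1 <= y' <= d1 -> cabs (g (x' +i* y')) <= e / 4 * s.
    move=> hx' hy'; have hs := cabs_rect xab1 ycd1 hx' hy'.
    apply: le_trans (Hr _ (le_lt_trans hs sr)) _.
    by rewrite ler_pM2l.
  have hl y' := @continuous_hline h y' ch; have vl x' := @continuous_vline h x' ch.
  have cB (f1 f2 : R -> R[i]) : continuous f1 -> continuous f2 ->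
      continuous (fun t => f1 t - f2 t).
    by move=> c1' c2' t; apply: (@continuousC_D _ _ f1);
      [exact: c1'|exact/continuousC_N/c2'].
  have cc (z : R[i]) : continuous (fun _ : R => z) by move=> t; exact: cvg_cst.
  have -> : rectint h a1 b1 c1 d1 =
    cint (fun t => h (t +i* c1) - h (t +i* d1) - l * 'i * (c1 - d1)%:C) a1 b1 +
    'i * cint (fun t => h (b1 +i* t) - h (a1 +i* t) - l * (b1 - a1)%:C) c1 d1.
    rewrite /rectint (cintB a1 b1 (cB _ _ (hl c1) (hl d1)) (cc _)).
    rewrite (cintB c1 d1 (cB _ _ (vl b1) (vl a1)) (cc _)).
    rewrite !cint_cst// !rmorphB /=; ring.
  have -> : e * s ^+ 2 =
      2 * (e / 2 * s) * (b1 - a1) + 2 * (e / 2 * s) * (d1 - c1).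
    by rewrite -mulrDr -/s; field.
  apply: le_trans (cabsD _ _) _; rewrite cabsM cabs_i mul1r.
  apply: lerD; apply: cabs_cint_le => //.
  - exact: (cB _ _ (cB _ _ (hl c1) (hl d1)) (cc _)).
  - move=> t tab; rewrite (_ : _ - _ = g (t +i* c1) - g (t +i* d1)).
      apply: le_trans (cabsD _ _) _; rewrite cabsN.
      have := gs t c1 tab; have := gs t d1 tab;
        rewrite !lexx cd1 => /(_ isT) A /(_ isT) B.
      by apply: le_trans (lerD B A) _; lra.
    rewrite /g; have -> : t +i* c1 = t%:C + 'i * c1%:C by simpc.
    have -> : t +i* d1 = t%:C + 'i * d1%:C by simpc.
    by rewrite rmorphB /=; ring.
  - exact: (cB _ _ (cB _ _ (vl b1) (vl a1)) (cc _)).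
  - move=> t tab; rewrite (_ : _ - _ = g (b1 +i* t) - g (a1 +i* t)).
      apply: le_trans (cabsD _ _) _; rewrite cabsN.
      have := gs b1 t; have := gs a1 t;
        rewrite !lexx ab1 => /(_ isT tab) A /(_ isT tab) B.
      by apply: le_trans (lerD B A) _; lra.
    rewrite /g; have -> : b1 +i* t = b1%:C + 'i * t%:C by simpc.
    have -> : a1 +i* t = a1%:C + 'i * t%:C by simpc.
    by rewrite rmorphB /=; ring.
apply: cabs_small_eq => e e0; rewrite subr0.
set s := (b - a + (d - c)) ^+ 2 in key.
have s0 : 0 <= s by exact: sqr_ge0.
apply: le_trans (key (e / (s + 1)) _) _; first by rewrite divr_gt0//; lra.
by rewrite mulrAC ler_pdivrMr; [rewrite ler_pM2l//; lra|lra].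
Qed.

End Goursat.

(** * Complex differentiability and the complex exponential *)

Section ComplexExp.
Variable R : realType.
Implicit Types (z w p t : R[i]) (h : R[i] -> R[i]).

Lemma complex_diffP h p : complex_diff_at h p <-> differentiable h p.
Proof.
split=> [[l Hl]|/derivable1_diffP].
  apply/derivable1_diffP/cvg_ex; exists l => A /nbhsC[e e0 HA].
  have e20 : 0 < e / 2 by rewrite divr_gt0.
  have [r r0 Hr] := Hl _ e20.
  apply/nbhsC; exists r => // t tr t0; apply: HA => /=.
  rewrite subr0 in tr.
  have -> : t^-1 *: (h (t *: 1 + p) - h p) - l
     = t^-1 * (h (t + p) - h p - l * (t + p - p)).
    rewrite addrK /GRing.scale /= mulr1; field.
    exact: t0.
  rewrite cabsM cabsV mulrC ltr_pdivrMr ?cabs_gt0//.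
  apply: le_lt_trans (Hr _ _) _; first by rewrite addrK.
  rewrite addrK ltr_pM2r ?cabs_gt0//; lra.
move=> /cvg_ex[l Hl]; exists l => e e0.
have /Hl/nbhsC[r r0 Hr] : nbhs l [set w | cabs (w - l) < e].
  by apply/nbhsC; exists e.
exists r => // w wr; have [->|wp] := eqVneq w p.
  by rewrite !subrr mulr0 subrr cabs0 mulr0.
have t0 : w - p != 0 by rewrite subr_eq0.
have /(_ _ t0) := Hr (w - p); rewrite subr0 => /(_ wr).
rewrite /= /GRing.scale /= mulr1 subrK => /ltW H.
have -> : h w - h p - l * (w - p) = ((w - p)^-1 * (h w - h p) - l) * (w - p).
  by field.
by rewrite cabsM ler_pM2r// cabs_gt0.
Qed.

Lemma real_diff_at (f : R -> R) (x l : R) : is_derive x 1 f l ->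
  forall e : R, 0 < e -> exists2 r : R, 0 < r & forall t : R, `|t| < r ->
    `|f (x + t) - f x - l * t| <= e * `|t|.
Proof.
move=> [/cvg_ex[l' Hl] dl] e e0.
have {dl} ll : l' = l by rewrite -dl; apply/esym/cvg_lim.
rewrite {}ll in Hl.
have /Hl[r /= r0 Hr] : nbhs l [set w | `|w - l| < e].
  by exists e => //= w; rewrite /ball_ /= distrC.
exists r => // t tr; have [->|t0] := eqVneq t 0.
  by rewrite addr0 subrr mulr0 subrr normr0 mulr0.
have := Hr t; rewrite /ball_ /= sub0r normrN => /(_ tr t0).
rewrite /GRing.scale /= mulr1 [t + x]addrC => /ltW H.
have -> : f (x + t) - f x - l * t = (t^-1 * (f (x + t) - f x) - l) * t by field.
by rewrite normrM; apply: ler_wpM2r H; exact: normr_ge0.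
Qed.

Definition cexp z : R[i] := (expR (Re z) * cos (Im z)) +i* (expR (Re z) * sin (Im z)).

Lemma cexpD z w : cexp (z + w) = cexp z * cexp w.
Proof.
case: z w => a b [c d]; rewrite /cexp /=; simpc.
by rewrite expRD cosD sinD; congr (_ +i* _); ring.
Qed.

Lemma cabs_cexp z : cabs (cexp z) = expR (Re z).
Proof.
rewrite /cabs /cexp /= !exprMn -mulrDr cos2Dsin2 mulr1 sqrtr_sqr.
by rewrite ger0_norm// expR_ge0.
Qed.

Lemma cexp_neq0 z : cexp z != 0.
Proof. by rewrite -cabs_gt0 cabs_cexp expR_gt0. Qed.

Lemma cexp_real (x y : R) : cexp (x +i* y) = (expR x)%:C * cexp (0 +i* y).
Proof. by rewrite /cexp /= expR0 !mul1r; simpc. Qed.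

Lemma cexp_period (x : R) : cexp (x +i* (2 * pi)) = cexp (x +i* 0).
Proof. by rewrite /cexp /= mulr_natl cos2pi sin2pi cos0 sin0. Qed.

Lemma cexp_diff z : complex_diff_at cexp z.
Proof.
suff H0 : forall e : R, 0 < e -> exists2 r : R, 0 < r & forall t, cabs t < r ->
    cabs (cexp t - 1 - t) <= e * cabs t.
  exists (cexp z) => e e0.
  have cz : 0 < cabs (cexp z) by rewrite cabs_gt0 cexp_neq0.
  have [r r0 Hr] := H0 (e / cabs (cexp z)) (divr_gt0 e0 cz).
  exists r => // w wr.
  rewrite -[in cexp w](subrK z w) cexpD.
  have -> : cexp (w - z) * cexp z - cexp z - cexp z * (w - z) =
    cexp z * (cexp (w - z) - 1 - (w - z)) by ring.
  rewrite cabsM; apply: le_trans (ler_wpM2l (ltW cz) (Hr _ wr)) _.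
  by rewrite mulrA [_ * (e / _)]mulrC divfK// gt_eqF.
move=> e e0.
(* The errors below add up to [9 d |t|]. *)
pose d := Num.min 1 (e / 9).
have d0 : 0 < d by rewrite /d lt_min; apply/andP; split; lra.
have d1 : d <= 1 by rewrite /d ge_min lexx.
have d2 : d <= e / 9 by rewrite /d ge_min lexx orbT.
clearbody d.
have [r1 r10 H1] := real_diff_at (is_derive_expR 0) d0.
have [r2 r20 H2] := real_diff_at (is_derive_cos 0) d0.
have [r3 r30 H3] := real_diff_at (is_derive_sin 0) d0.
pose r := Num.min (Num.min r1 r2) (Num.min r3 d).
exists r; first by rewrite /r !lt_min r10 r20 r30 d0.
move=> t; rewrite /r !lt_min => /andP[/andP[tr1 tr2] /andP[tr3 td]].
have xt := Re_le_cabs t; have yt := Im_le_cabs t.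
set x := Re t in xt *; set y := Im t in yt *; set T := cabs t in xt yt td tr1 tr2 tr3 *.
have {H1} := H1 x (le_lt_trans xt tr1); rewrite add0r expR0 mul1r => H1.
have {H2} := H2 y (le_lt_trans yt tr2).
rewrite add0r cos0 sin0 oppr0 mul0r subr0 => H2.
have {H3} := H3 y (le_lt_trans yt tr3).
rewrite add0r cos0 sin0 subr0 mul1r => H3.
apply: le_trans (cabs_le_ReIm _) _.
have -> : Re (cexp t - 1 - t) =
    (expR x - 1 - x) * 1 + expR x * (cos y - 1).
  by rewrite /x /y; case: t {xt yt T td tr1 tr2 tr3 H1 H2 H3 x y} => a b;
    rewrite /cexp /=; ring.
have -> : Im (cexp t - 1 - t) = (expR x - 1) * y + expR x * (sin y - y).
  by rewrite /x /y; case: t {xt yt T td tr1 tr2 tr3 H1 H2 H3 x y} => a b;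
    rewrite /cexp /=; ring.
have T0 : 0 <= T by exact: cabs_ge0.
have dT : d * T <= T by rewrite ler_piMl.
have A1 : `|expR x - 1 - x| <= d * T by apply: le_trans H1 _; rewrite ler_pM2l.
have A2 : `|cos y - 1| <= d * T by apply: le_trans H2 _; rewrite ler_pM2l.
have A3 : `|sin y - y| <= d * T by apply: le_trans H3 _; rewrite ler_pM2l.
have A4 : `|expR x - 1| <= 2 * T.
  have -> : expR x - 1 = (expR x - 1 - x) + x by ring.
  by apply: le_trans (ler_normD _ _) _; lra.
have A5 : `|expR x| <= 3.
  have -> : expR x = (expR x - 1) + 1 by ring.
  by apply: le_trans (ler_normD _ _) _; rewrite normr1; lra.
have B1 : `|(expR x - 1 - x) * 1 + expR x * (cos y - 1)| <= 4 * (d * T).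
  apply: le_trans (ler_normD _ _) _; rewrite mulr1 normrM.
  have := ler_pM (normr_ge0 _) (normr_ge0 _) A5 A2; lra.
have B2 : `|(expR x - 1) * y + expR x * (sin y - y)| <= 2 * T * d + 3 * (d * T).
  apply: le_trans (ler_normD _ _) _; rewrite !normrM; apply: lerD.
    by apply: ler_pM => //; apply: le_trans yt _; exact: ltW.
  exact: ler_pM.
apply: le_trans (lerD B1 B2) _.
have := ler_wpM2r T0 d2; lra.
Qed.

Lemma continuous_diff h : (forall z, complex_diff_at h z) -> continuous h.
Proof. by move=> dh z; apply: differentiable_continuous; apply/complex_diffP. Qed.

Lemma continuous_cexp : continuous cexp.
Proof. by apply: continuous_diff => z; exact: cexp_diff. Qed.

Lemma cdiff_comp h g z : complex_diff_at g z -> complex_diff_at h (g z) ->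
  complex_diff_at (fun w => h (g w)) z.
Proof.
by move=> /complex_diffP dg /complex_diffP dh; apply/complex_diffP;
  exact: (differentiable_comp dg dh).
Qed.
Lemma cdiffM h g z : complex_diff_at h z -> complex_diff_at g z ->
  complex_diff_at (fun w => h w * g w) z.
Proof.
by move=> /complex_diffP dg /complex_diffP dh; apply/complex_diffP;
  exact: (differentiableM dg dh).
Qed.
Lemma cdiffD h g z : complex_diff_at h z -> complex_diff_at g z ->
  complex_diff_at (fun w => h w + g w) z.
Proof.
by move=> /complex_diffP dg /complex_diffP dh; apply/complex_diffP;
  exact: (differentiableD dg dh).
Qed.
Lemma cdiffV h z : h z != 0 -> complex_diff_at h z ->
  complex_diff_at (fun w => (h w)^-1) z.
Proof.
by move=> hz /complex_diffP dg; apply/complex_diffP;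
  exact: (differentiableV dg hz).
Qed.
Lemma cdiff_cst (c z : R[i]) : complex_diff_at (fun=> c) z.
Proof.
by exists 0 => e e0; exists 1 => // w _;
  rewrite subrr mul0r subr0 cabs0 mulr_ge0 ?cabs_ge0// ltW.
Qed.
Lemma cdiff_id z : complex_diff_at (fun w => w) z.
Proof.
by exists 1 => e e0; exists 1 => // w _;
  rewrite mul1r subrr cabs0 mulr_ge0 ?cabs_ge0// ltW.
Qed.
Lemma cdiffX h n z : complex_diff_at h z -> complex_diff_at (fun w => h w ^+ n) z.
Proof.
move=> dh; elim: n => [|n IH]; first exact: cdiff_cst.
rewrite (_ : (fun w => _) = (fun w => h w * h w ^+ n)); first exact: cdiffM.
by apply/funext => w; rewrite exprS.
Qed.
End ComplexExp.

(** * Circle means and Taylor's formula with Cauchy's estimates *)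

Section CircleMeans.
Variable R : realType.
Implicit Types (z w p : R[i]) (h g : R[i] -> R[i]).

Lemma cdiff_near h h' p (r : R) : 0 < r ->
  (forall w, cabs (w - p) < r -> h w = h' w) ->
  complex_diff_at h p -> complex_diff_at h' p.
Proof.
move=> r0 hh' [l Hl]; exists l => e e0; have [s s0 Hs] := Hl e e0.
exists (Num.min r s); first by rewrite lt_min r0.
move=> w; rewrite lt_min => /andP[wr ws].
by rewrite -!hh' ?subrr ?cabs0//; exact: Hs.
Qed.

Lemma pi2_gt0 : 0 < 2 * pi :> R.
Proof. by rewrite mulr_gt0// pi_gt0. Qed.

Lemma continuousC_Z (f : R -> R[i]) z : continuous f ->
  continuous (fun t => z * f t).
Proof.
by move=> cf t; apply: (@continuousC_M _ _ (fun=> z) f); [exact: cvg_cst|exact: cf].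
Qed.

Definition Jint h (x : R) : R[i] := cint (fun y => h (x +i* y)) 0 (2 * pi).

Lemma continuous_Jint h : continuous h -> continuous (Jint h).
Proof.
move=> ch; apply: (@cint_param_continuous R R (fun q => h (q.1 +i* q.2))).
  exact/ltW/pi2_gt0.
move=> q; apply: (@continuous_comp _ _ _ (fun q : R * R => q.1 +i* q.2) h);
  last exact: ch.
apply: (@continuous_complex _ _ (fun q : R * R => q.1) (fun q : R * R => q.2)).
  exact: cvg_fst.
exact: cvg_snd.
Qed.

(** On a rectangle one period high the horizontal sides cancel, which leaves
    the difference of two vertical integrals; the exceptional vertical line is
    crossed by continuity. *)
Lemma Jint_const h (x0 : R) : continuous h ->
  (forall x, h (x +i* (2 * pi)) = h (x +i* 0)) ->
  (forall x y, x != x0 -> complex_diff_at h (x +i* y)) ->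
  forall x1 x2, Jint h x1 = Jint h x2.
Proof.
move=> ch hper dh.
have p2 := ltW pi2_gt0.
have same a b : a <= b -> (forall x, a <= x <= b -> x != x0) -> Jint h a = Jint h b.
  move=> ab nx.
  have G : rectint h a b 0 (2 * pi) = 0.
    by apply: goursat => // x y xab _; apply: dh; exact: nx.
  have vl x := @continuous_vline R h x ch.
  move: G; rewrite /rectint (cintB _ _ (vl b) (vl a)).
  rewrite (@eq_cint _ _ (fun=> 0)); last by move=> t _; rewrite hper subrr.
  rewrite cint_cst// mul0r add0r => /eqP; rewrite mulf_eq0 => /orP[/eqP i0|].
    by have := congr1 (@cabs R) i0; rewrite cabs_i cabs0 => /eqP; rewrite oner_eq0.
  by rewrite subr_eq0 /Jint => /eqP ->.
have toc x : Jint h x = Jint h x0.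
  apply: cabs_small_eq => e e0.
  have cJ : {for x0, continuous (Jint h)} by exact: continuous_Jint.
  have /continuousC/(_ _ e0)[r r0 Hr] := cJ.
  have {}r0 : 0 < r by [].
  simpl in Hr.
  have [xx0|xx0|->] := ltgtP x x0.
  - pose x' := Num.max x (x0 - r / 2).
    have h1 : x <= x' by rewrite le_max lexx.
    have h2 : x' < x0 by rewrite gt_max xx0; lra.
    have h3 : x0 - r / 2 <= x' by rewrite le_max lexx orbT.
    rewrite (@same x x')//; last first.
      by move=> t /andP[_ t1]; rewrite lt_eqF//; exact: le_lt_trans t1 h2.
    by apply/ltW/Hr; rewrite /ball_ /= ger0_norm; lra.
  - pose x' := Num.min x (x0 + r / 2).
    have h1 : x' <= x by rewrite ge_min lexx.
    have h2 : x0 < x' by rewrite lt_min xx0; lra.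
    have h3 : x' <= x0 + r / 2 by rewrite ge_min lexx orbT.
    rewrite -(@same x' x)//; last first.
      by move=> t /andP[t1 _]; rewrite gt_eqF//; exact: lt_le_trans h2 t1.
    by apply/ltW/Hr; rewrite /ball_ /= ler0_norm; lra.
  - by rewrite subrr cabs0 ltW.
by move=> x1 x2; rewrite !toc.
Qed.

Definition ucirc (y : R) : R[i] := cexp (0 +i* y).

Lemma cabs_ucirc y : cabs (ucirc y) = 1.
Proof. by rewrite cabs_cexp expR0. Qed.

Lemma ucirc_neq0 y : ucirc y != 0. Proof. exact: cexp_neq0. Qed.

Lemma continuous_ucirc : continuous ucirc.
Proof. exact: (@continuous_vline R (@cexp R) 0 (@continuous_cexp R)). Qed.

Definition cmean g : R[i] :=
  (2 * pi)%:C^-1 * cint (fun y => g (ucirc y)) 0 (2 * pi).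

Let p2 := ltW pi2_gt0.
Let pC0 : (2 * pi : R)%:C != 0.
Proof. by rewrite -cabs_gt0 cabs_real gtr0_norm pi2_gt0. Qed.

Lemma eq_cmean g h : (forall w, cabs w = 1 -> g w = h w) -> cmean g = cmean h.
Proof.
by move=> gh; rewrite /cmean; congr (_ * _); apply: eq_cint => y _; apply: gh;
  exact: cabs_ucirc.
Qed.

Lemma cmean_cst z : cmean (fun=> z) = z.
Proof. by rewrite /cmean cint_cst// subr0 mulrC mulfK. Qed.

Lemma cmeanD g h : continuous (fun y => g (ucirc y)) ->
  continuous (fun y => h (ucirc y)) ->
  cmean (fun w => g w + h w) = cmean g + cmean h.
Proof.
by move=> cg ch; rewrite /cmean (cintD 0 (2 * pi) cg ch) mulrDr.
Qed.

Lemma cmeanB g h : continuous (fun y => g (ucirc y)) ->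
  continuous (fun y => h (ucirc y)) ->
  cmean (fun w => g w - h w) = cmean g - cmean h.
Proof.
by move=> cg ch; rewrite /cmean (cintB 0 (2 * pi) cg ch) mulrBr.
Qed.

Lemma cmeanZ g z : continuous (fun y => g (ucirc y)) ->
  cmean (fun w => z * g w) = z * cmean g.
Proof. by move=> cg; rewrite /cmean (cintZ z 0 (2 * pi) cg) mulrCA. Qed.

Lemma cmean_sum n (g : 'I_n -> R[i] -> R[i]) :
  (forall i, continuous (fun y => g i (ucirc y))) ->
  cmean (fun w => \sum_(i < n) g i w) = \sum_(i < n) cmean (g i).
Proof.
move=> cg; rewrite /cmean.
by rewrite (@cint_sum _ _ _ (fun i y => g i (ucirc y)))// -mulr_sumr.
Qed.

Lemma cabs_cmean_le g (M : R) : continuous (fun y => g (ucirc y)) ->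
  (forall w, cabs w = 1 -> cabs (g w) <= M) -> cabs (cmean g) <= 2 * M.
Proof.
move=> cg gM; rewrite /cmean cabsM cabsV cabs_real gtr0_norm ?pi2_gt0//.
rewrite mulrC ler_pdivrMr ?pi2_gt0// -[X in _ <= _ * X]subr0.
by apply: cabs_cint_le => // t _; apply: gM; exact: cabs_ucirc.
Qed.

(** In the variable [log w] the mean over circles becomes an integral over one
    period, independent of the radius; it tends to the value at 0 as the
    radius shrinks. A circle of exceptional points is allowed because the
    removable singularity in [taylor_remainder] lies on one. *)
Lemma mean_value h (s0 r : R) : continuous h ->
  (forall w, cabs w != s0 -> complex_diff_at h w) -> 0 < r ->
  cmean (fun w => h (r%:C * w)) = h 0.
Proof.
move=> ch dh r0.
pose k w := h (cexp w).
have ck : continuous k.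
  by move=> w; apply: (@continuous_comp _ _ _ (@cexp R) h);
    [exact: continuous_cexp|exact: ch].
have JE : forall x1 x2, Jint k x1 = Jint k x2.
  apply: (@Jint_const _ (ln s0)) => //.
    by move=> x; rewrite /k cexp_period.
  move=> x y xs; apply: cdiff_comp; first exact: cexp_diff.
  by apply: dh; rewrite cabs_cexp /=; apply: contra xs => /eqP <-; rewrite expRK.
have -> : cmean (fun w => h (r%:C * w)) = (2 * pi)%:C^-1 * Jint k (ln r).
  rewrite /cmean /Jint; congr (_ * _); apply: eq_cint => t _.
  by rewrite /k cexp_real lnK ?posrE.
apply: cabs_small_eq => e e0.
have e20 : 0 < e / 2 by rewrite divr_gt0.
have ch0 : {for 0, continuous h} by exact: ch.
have /continuousC/(_ _ e20)/nbhsC[s s0' Hs] := ch0.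
have s20 : 0 < s / 2 by rewrite divr_gt0.
rewrite (JE _ (ln (s / 2))).
have -> : (2 * pi)%:C^-1 * Jint k (ln (s / 2)) - h 0 =
    cmean (fun w => h ((s / 2)%:C * w) - h 0).
  rewrite /cmean (@cintB _ (fun y => h ((s / 2)%:C * ucirc y)) (fun=> h 0)).
  - rewrite mulrBr cint_cst// subr0 [_ * (h 0 * _)]mulrC mulfK//.
    congr (_ * _ - _); apply: eq_cint => t _.
    by rewrite /k cexp_real lnK ?posrE.
  - move=> y; apply: (@continuous_comp _ _ _ (fun y => (s / 2)%:C * ucirc y) h);
    last exact: ch.
    by apply: (@continuousC_M _ _ (fun=> _)); [exact: cvg_cst|exact: continuous_ucirc].
  - by move=> y; exact: cvg_cst.
have -> : e = 2 * (e / 2) by field.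
apply: cabs_cmean_le.
  move=> y; apply: (@continuousC_D _ _ (fun y => h ((s / 2)%:C * ucirc y)));
    last exact: cvg_cst.
  apply: (@continuous_comp _ _ _ (fun y => (s / 2)%:C * ucirc y) h); last exact: ch.
  by apply: (@continuousC_M _ _ (fun=> _)); [exact: cvg_cst|exact: continuous_ucirc].
move=> w w1; apply/ltW/Hs; rewrite subr0 cabsM w1 mulr1 cabs_real gtr0_norm//; lra.
Qed.

(** The [k]-th Taylor coefficient at 0, as a Fourier coefficient on the unit
    circle. *)
Definition tcoef g (k : nat) : R[i] := cmean (fun w => g w * w^-1 ^+ k).

Lemma continuous_Xn (f : R -> R[i]) n : continuous f -> continuous (fun y => f y ^+ n).
Proof.
move=> cf; elim: n => [|n IH] y; first by rewrite (_ : (fun y => _) = fun=> 1)//;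
  exact: cvg_cst.
rewrite (_ : (fun y => _) = (fun y => f y * f y ^+ n)); last first.
  by apply/funext => t; rewrite exprS.
by apply: (@continuousC_M _ _ f); [exact: cf|exact: IH].
Qed.

Lemma continuous_scaled_circ (r : R) : continuous (fun y => r%:C * ucirc y).
Proof.
by move=> y; apply: (@continuousC_M _ _ (fun=> _));
  [exact: cvg_cst|exact: continuous_ucirc].
Qed.

Lemma continuous_inv_circ (r : R) n : r != 0 ->
  continuous (fun y => (r%:C * ucirc y)^-1 ^+ n).
Proof.
move=> r0; apply: continuous_Xn => y;
  apply: (@continuousC_V _ _ (fun y => r%:C * ucirc y));
    last exact: continuous_scaled_circ.
by rewrite mulf_neq0 ?ucirc_neq0// -cabs_gt0 cabs_real normr_gt0.
Qed.

Lemma continuous_on_circ g (r : R) : continuous g -> continuous (fun y => g (r%:C *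
  ucirc y)).
Proof.
move=> cg y; apply: (@continuous_comp _ _ _ (fun y => r%:C * ucirc y) g); last exact: cg.
exact: continuous_scaled_circ.
Qed.

Lemma continuous_coef_integrand g (r : R) n : r != 0 -> continuous g ->
  continuous (fun y => g (r%:C * ucirc y) * (r%:C * ucirc y)^-1 ^+ n).
Proof.
move=> r0 cg y; apply: (@continuousC_M _ _ (fun y => g (r%:C * ucirc y))).
  exact: continuous_on_circ.
exact: continuous_inv_circ.
Qed.

Lemma continuous_one_coef k : continuous (fun y => 1 * (ucirc y)^-1 ^+ k).
Proof.
rewrite (_ : (fun y => _) = (fun y => 1 * (1%:C * ucirc y)^-1 ^+ k)).
  apply: (@continuous_coef_integrand (fun=> 1)); first exact: oner_neq0.
  exact: cst_continuous.
by apply/funext => t; rewrite -[1%:C]/(1 : R[i]) !mul1r.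
Qed.

Lemma tcoef_radius g k (r : R) : (forall z, complex_diff_at g z) -> 0 < r ->
  tcoef g k = cmean (fun w => g (r%:C * w) * (r%:C * w)^-1 ^+ k).
Proof.
move=> dg r0.
pose h w := g (cexp w) * (cexp w)^-1 ^+ k.
have dh w : complex_diff_at h w.
  apply: cdiffM; first by apply: cdiff_comp => //; exact: cexp_diff.
  apply: cdiffX; apply: cdiffV; [exact: cexp_neq0|exact: cexp_diff].
have JE : forall x1 x2, Jint h x1 = Jint h x2.
  apply: (@Jint_const _ 0); first exact: continuous_diff.
    by move=> x; rewrite /h cexp_period.
  by move=> x y _; exact: dh.
have JJ : cint (fun y => g (ucirc y) * (ucirc y)^-1 ^+ k) 0 (2 * pi) =
    cint (fun y => g (r%:C * ucirc y) * (r%:C * ucirc y)^-1 ^+ k) 0 (2 * pi).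
  rewrite -[LHS]/(Jint h 0) (JE 0 (ln r)) /Jint; apply: eq_cint => t _.
  by rewrite /h cexp_real lnK ?posrE.
exact: (congr1 (fun z => (2 * pi)%:C^-1 * z) JJ).
Qed.

Lemma tcoef_le g k (r M : R) : (forall z, complex_diff_at g z) -> 0 < r ->
  (forall w, cabs w = r -> cabs (g w) <= M) ->
  cabs (tcoef g k) <= 2 * (M / r ^+ k).
Proof.
move=> dg r0 gM; rewrite (tcoef_radius k dg r0).
have cr w : cabs w = 1 -> cabs (r%:C * w) = r.
  by move=> w1; rewrite cabsM w1 mulr1 cabs_real gtr0_norm.
apply: cabs_cmean_le.
  by apply: continuous_coef_integrand; [rewrite gt_eqF|exact: continuous_diff].
move=> w w1; rewrite cabsM cabsX cabsV cr// exprVn ler_pM2r ?invr_gt0 ?exprn_gt0//.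
by apply: gM; exact: cr.
Qed.

(** The mean of [w ^ -k] on a circle is independent of the radius, and scales
    like its [-k]-th power. *)
Lemma tcoef1 k : tcoef (fun=> 1) k = (k == 0%N)%:R.
Proof.
case: k => [|k] /=.
  rewrite /tcoef (@eq_cmean _ (fun=> 1)) ?cmean_cst// => w _.
  by rewrite expr0 mulr1.
have d1 z : complex_diff_at (fun=> 1) z := cdiff_cst 1 z.
have := tcoef_radius k.+1 d1 (ltr0n R 2).
have -> : cmean (fun w => 1 * (2%:R%:C * w)^-1 ^+ k.+1) =
   2%:R%:C^-1 ^+ k.+1 * tcoef (fun=> 1) k.+1.
  rewrite /tcoef -(@cmeanZ (fun w => 1 * w^-1 ^+ k.+1) _ (@continuous_one_coef _)).
  by apply: eq_cmean => w _; rewrite !mul1r invfM exprMn.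
set c := tcoef _ _; set q := _ ^+ _; move=> cq.
have : (1 - q) * c = 0 by rewrite mulrBl mul1r -cq subrr.
move=> /eqP; rewrite mulf_eq0 => /orP[|/eqP //].
rewrite subr_eq0 => /eqP q1; exfalso.
have : cabs q = 1 by rewrite -q1 cabs1.
rewrite /q cabsX cabsV cabs_real ger0_norm//.
apply/eqP; rewrite lt_eqF// exprn_ilt1//; rewrite ?invr_ge0// ?ler0n//.
by rewrite invf_lt1 ?ltr1n// ltr0n.
Qed.

(** Taylor's formula with remainder. The mean value property is applied to
    [w (g w - g z) / (w - z)], which vanishes at 0, and [w / (w - z)] is
    expanded in powers of [z / w]. *)
Lemma taylor_remainder g z (r M : R) n : (forall w, complex_diff_at g w) -> 0 < r ->
  cabs z <= r / 2 -> (forall w, cabs w <= r -> cabs (g w) <= M) ->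
  cabs (g z - \sum_(k < n.+1) tcoef g k * z ^+ k) <= 8 * M * (cabs z / r) ^+ n.+1.
Proof.
move=> dg r0 zr gM.
have cg := continuous_diff dg.
have [l Hl] := dg z.
(* the difference quotient, with its singularity at z removed *)
pose q w := if w == z then l else (g w - g z) * (w - z)^-1.
pose phi w := q w * w.
have dsub w : complex_diff_at (fun w => w - z) w.
  by apply: cdiffD; [exact: cdiff_id|exact: cdiff_cst].
have dq w : w != z -> complex_diff_at q w.
  move=> wz; have w0 : 0 < cabs (w - z) by rewrite cabs_gt0 subr_eq0.
  apply: (@cdiff_near (fun w => (g w - g z) * (w - z)^-1) _ _ _ w0).
    move=> v vw; rewrite /q; case: eqP => // vz; exfalso.
    by rewrite vz cabsB ltxx in vw.
  apply: cdiffM; first by apply: cdiffD => //; exact: cdiff_cst.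
  by apply: cdiffV => //; rewrite subr_eq0.
have cq : continuous q.
  move=> w; have [->|wz] := eqVneq w z; last first.
    by apply: differentiable_continuous; apply/complex_diffP; exact: dq.
  apply/continuousC => e e0; have e20 : 0 < e / 2 by rewrite divr_gt0.
  have [s s0 Hs] := Hl _ e20; apply/nbhsC; exists s => // v vz.
  rewrite /q eqxx; case: eqP => [_|/eqP vz']; first by rewrite subrr cabs0.
  have vz0 : v - z != 0 by rewrite subr_eq0.
  have -> : (g v - g z) * (v - z)^-1 - l = (g v - g z - l * (v - z)) * (v - z)^-1.
    by field.
  rewrite cabsM cabsV ltr_pdivrMr ?cabs_gt0//.
  apply: le_lt_trans (Hs _ vz) _; rewrite ltr_pM2r ?cabs_gt0//; lra.
have cphi : continuous phi.
  by move=> w; apply: (@continuousC_M _ _ q); [exact: cq|exact: cvg_id].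
have dphi w : cabs w != cabs z -> complex_diff_at phi w.
  move=> wz; apply: cdiffM; last exact: cdiff_id.
  by apply: dq; apply: contra wz => /eqP ->.
have := mean_value cphi dphi r0; rewrite {2}/phi mulr0 => MV.
have M0 : 0 <= M by apply: le_trans (cabs_ge0 (g 0)) (gM 0 _); rewrite cabs0 ltW.
have gzM : cabs (g z) <= M by apply: gM; lra.
have rC w : cabs w = 1 -> cabs (r%:C * w) = r.
  by move=> w1; rewrite cabsM w1 mulr1 cabs_real gtr0_norm.
have r_neq0 : r != 0 by rewrite gt_eqF.
pose rem w := (g (r%:C * w) - g z) *
   ((z * (r%:C * w)^-1) ^+ n.+1 * ((r%:C * w) * (r%:C * w - z)^-1)).
pose T k w := z ^+ k * (g (r%:C * w) * (r%:C * w)^-1 ^+ k) -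
              (g z * z ^+ k) * (1 * (r%:C * w)^-1 ^+ k).
have Wz w : cabs w = 1 -> r%:C * w - z != 0.
  by move=> w1; rewrite subr_eq0; apply/eqP => wz; move: zr; rewrite -wz rC//; lra.
have phiE w : cabs w = 1 -> phi (r%:C * w) = \sum_(k < n.+1) T k w + rem w.
  move=> w1; have W0 : r%:C * w != 0 by rewrite -cabs_gt0 rC.
  have Wz0 := Wz _ w1.
  rewrite /phi /q; case: eqP => [wz|_]; first by move: Wz0; rewrite wz subrr eqxx.
  rewrite /rem /T; set W := r%:C * w in W0 Wz0 *.
  have -> : \sum_(k < n.+1) (z ^+ k * (g W * W^-1 ^+ k) - g z * z ^+ k * (1 * W^-1 ^+ k))
    = (g W - g z) * \sum_(k < n.+1) (z * W^-1) ^+ k.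
    rewrite mulr_sumr; apply: eq_bigr => k _; rewrite exprMn; ring.
  rewrite -mulrDr -mulrA; congr (_ * _).
  have q1 : 1 - z * W^-1 != 0.
    have -> : 1 - z * W^-1 = (W - z) / W by field; exact: W0.
    by rewrite mulf_neq0// invr_neq0.
  have := subrX1 (z * W^-1) n.+1; set S := \sum_(i < n.+1) _; set Q := _ ^+ n.+1 => QS.
  have -> : S = (1 - Q) / (1 - z * W^-1).
    by apply: (mulIf q1); rewrite divfK// -[1 - Q]opprB QS; ring.
  by field; rewrite W0 Wz0.
have cone : continuous (fun _ : R[i] => 1 : R[i]) by exact: cst_continuous.
have cT k : continuous (fun y => T k (ucirc y)).
  move=> y; apply: (@continuousC_D _ _ (fun y => z ^+ k * (g (r%:C * ucirc y) * (r%:C *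
    ucirc y)^-1 ^+ k))).
    by apply: (@continuousC_M _ _ (fun=> z ^+ k));
      [exact: cvg_cst|exact: continuous_coef_integrand].
  apply: continuousC_N; apply: (@continuousC_M _ _ (fun=> g z * z ^+ k));
    first exact: cvg_cst.
  exact: (@continuous_coef_integrand (fun=> 1) r k r_neq0 cone).
have crem : continuous (fun y => rem (ucirc y)).
  have -> : (fun y => rem (ucirc y)) =
     (fun y => phi (r%:C * ucirc y) - \sum_(k < n.+1) T k (ucirc y)).
    by apply/funext => y; rewrite phiE ?cabs_ucirc// addrC addKr.
  move=> y; apply: (@continuousC_D _ _ (fun y => phi (r%:C * ucirc y))).
    exact: continuous_on_circ.
  apply: continuousC_N; elim: (index_enum _) => [|i s IH].
    rewrite (_ : (fun _ => _) = fun=> 0); first exact: cvg_cst.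
    by apply/funext => t; rewrite big_nil.
  rewrite (_ : (fun _ => _) = fun t => T i (ucirc t) + \sum_(k <- s) T k (ucirc t)).
    by apply: (@continuousC_D _ _ (fun t => T i (ucirc t))); [exact: cT|exact: IH].
  by apply/funext => t; rewrite big_cons.
have cTm k : cmean (T k) = z ^+ k * tcoef g k - g z * z ^+ k * (k == 0%N)%:R.
  have dc1 w : complex_diff_at (fun=> 1) w := cdiff_cst 1 w.
  rewrite -(tcoef1 k) (tcoef_radius k dg r0) (tcoef_radius k dc1 r0).
  have c1 := @continuous_coef_integrand g r k r_neq0 cg.
  have c2 := @continuous_coef_integrand (fun=> 1) r k r_neq0 cone.
  rewrite -(@cmeanZ (fun w => g (r%:C * w) * (r%:C * w)^-1 ^+ k) _ c1).
  rewrite -(@cmeanZ (fun w => 1 * (r%:C * w)^-1 ^+ k) _ c2).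
  have c1' : continuous (fun y =>
      z ^+ k * (g (r%:C * ucirc y) * (r%:C * ucirc y)^-1 ^+ k)).
    exact: (@continuousC_Z _ (z ^+ k) c1).
  have c2' : continuous (fun y =>
      g z * z ^+ k * (1 * (r%:C * ucirc y)^-1 ^+ k)).
    exact: (@continuousC_Z _ (g z * z ^+ k) c2).
  exact: (@cmeanB (fun w => z ^+ k * (g (r%:C * w) * (r%:C * w)^-1 ^+ k))
    (fun w => g z * z ^+ k * (1 * (r%:C * w)^-1 ^+ k)) c1' c2').
have sumE : cmean (fun w => phi (r%:C * w)) =
    \sum_(k < n.+1) cmean (T k) + cmean rem.
  have cS : continuous (fun y => \sum_(i < n.+1) T i (ucirc y)).
    have -> : (fun y => \sum_(i < n.+1) T i (ucirc y)) =
       (fun y => phi (r%:C * ucirc y) - rem (ucirc y)).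
      by apply/funext => y; rewrite phiE ?cabs_ucirc// addrK.
    move=> y; apply: (@continuousC_D _ _ (fun y => phi (r%:C * ucirc y))).
      exact: continuous_on_circ.
    by apply: continuousC_N; exact: crem.
  rewrite -(@cmean_sum n.+1 (fun k : 'I_n.+1 => T k) (fun k => cT k)).
  rewrite -(@cmeanD (fun w => \sum_(i < n.+1) T i w) rem cS crem).
  exact: eq_cmean.
have -> : g z - \sum_(k < n.+1) tcoef g k * z ^+ k = cmean rem.
  move: sumE; rewrite MV => /esym/eqP; rewrite addrC addr_eq0 => /eqP ->.
  under [in RHS]eq_bigr do rewrite cTm.
  rewrite big_split /= sumrN opprB; congr (_ - _).
    rewrite big_ord_recl /= expr0 !mulr1 big1 ?addr0// => i _.
    by rewrite /= mulr0.
  by apply: eq_bigr => i _; rewrite mulrC.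
have -> : 8 * M * (cabs z / r) ^+ n.+1 = 2 * (2 * M * ((cabs z / r) ^+ n.+1 * 2)).
  by ring.
apply: (@cabs_cmean_le rem _ crem) => w w1; rewrite /rem !cabsM cabsX cabsM !cabsV !rC//.
apply: ler_pM => //; rewrite ?cabs_ge0//.
- by rewrite !mulr_ge0// ?exprn_ge0 ?mulr_ge0 ?invr_ge0 ?cabs_ge0// ltW.
- rewrite mulr_natl mulr2n; apply: le_trans (cabsD _ _) _; rewrite cabsN.
  by apply: lerD => //; apply: gM; rewrite rC.
- rewrite ler_wpM2l ?exprn_ge0 ?mulr_ge0 ?invr_ge0 ?cabs_ge0// ?(ltW r0)//.
  rewrite w1 mulr1 cabs_real gtr0_norm// ler_pdivrMr ?cabs_gt0 ?Wz//.
  have := cabsD (r%:C * w - z) z; rewrite subrK rC//; lra.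
Qed.

End CircleMeans.

(** * Homogeneous expansion of an entire function of several variables *)

Section HomogeneousExpansion.
Variable R : realType.
Implicit Types (z w : R[i]) (g : R[i] -> R[i]).

Lemma in_seg (x r : R) : `|x| <= r -> `[- r, r]%classic x.
Proof. by move=> xr; rewrite /= in_itv /= -ler_norml. Qed.

Lemma continuous_pair (S T U : topologicalType) (f : S -> T) (g : S -> U) :
  continuous f -> continuous g -> continuous (fun s => (f s, g s)).
Proof. by move=> cf cg s; exact: (cvg_pair (cf s) (cg s)). Qed.

Lemma continuous_compo (S T U : topologicalType) (f : S -> T) (g : T -> U) :
  continuous f -> continuous g -> continuous (fun s => g (f s)).
Proof. by move=> cf cg s; apply: (@continuous_comp _ _ _ f g); [exact: cf|exact: cg]. Qed.

Lemma continuous_fst (S T : topologicalType) : continuous (@fst S T).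
Proof. by move=> q; exact: cvg_fst. Qed.

Lemma continuous_snd (S T : topologicalType) : continuous (@snd S T).
Proof. by move=> q; exact: cvg_snd. Qed.

Lemma bounded_bidisc (G : R[i] * R[i] -> R[i]) (r : R) : continuous G ->
  exists M, forall z w, cabs z <= r -> cabs w <= r -> cabs (G (z, w)) <= M.
Proof.
move=> cG.
pose I := `[- r, r]%classic : set R.
have cI : compact I := @segment_compact R (- r) r.
pose f (q : (R * R) * (R * R)) : R := cabs (G (q.1.1 +i* q.1.2, q.2.1 +i* q.2.2)).
have cC (T : topologicalType) (u v : T -> R) : continuous u -> continuous v ->
    continuous (fun t => u t +i* v t).
  by move=> cu cv t; apply: continuous_complex; [exact: cu|exact: cv].
have c1 := continuous_fst; have c2 := continuous_snd.
have cf : continuous f.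
  apply: (@continuous_compo _ _ _ (fun q => G (q.1.1 +i* q.1.2, q.2.1 +i* q.2.2))
    (@cabs R));
    last exact: continuous_cabs.
  apply: (@continuous_compo _ _ _ (fun q => (q.1.1 +i* q.1.2, q.2.1 +i* q.2.2)) G);
    last exact: cG.
  apply: (@continuous_pair _ _ _ (fun q : (R * R) * (R * R) => q.1.1 +i* q.1.2)
    (fun q : (R * R) * (R * R) => q.2.1 +i* q.2.2)).
    apply: (cC _ (fun q : (R * R) * (R * R) => q.1.1) (fun q => q.1.2)).
      exact: (continuous_compo (c1 _ _) (c1 _ _)).
    exact: (continuous_compo (c1 _ _) (c2 _ _)).
  apply: (cC _ (fun q : (R * R) * (R * R) => q.2.1) (fun q => q.2.2)).
    exact: (continuous_compo (c2 _ _) (c1 _ _)).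
  exact: (continuous_compo (c2 _ _) (c2 _ _)).
have cK := compact_setX (compact_setX cI cI) (compact_setX cI cI).
have := continuous_compact (continuous_subspaceT cf) cK.
move=> /compact_bounded[M [_ /(_ (M + 1))]]; rewrite ltrDl ltr01 => /(_ isT) HM.
exists (M + 1) => z w zr wr.
have := HM (f ((Re z, Im z), (Re w, Im w))).
have -> : f ((Re z, Im z), (Re w, Im w)) = cabs (G (z, w)).
  by rewrite /f; case: z {zr} => ? ?; case: w {wr} => ? ?.
move=> H; apply: le_trans (ler_norm _) _; apply: H.
exists ((Re z, Im z), (Re w, Im w)); last first.
  by rewrite /f; case: z {zr} => ? ?; case: w {wr} => ? ?.
by do 2 split => /=; apply: in_seg; apply: le_trans; [exact: Re_le_cabs|exact: zr|
  exact: Im_le_cabs|exact: zr|exact: Re_le_cabs|exact: wr|exact: Im_le_cabs|exact: wr].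
Qed.

Lemma bounded_disc g (r : R) : continuous g ->
  exists M, forall z, cabs z <= r -> cabs (g z) <= M.
Proof.
move=> cg; have cG : continuous (fun q : R[i] * R[i] => g q.1).
  by apply: (@continuous_compo _ _ _ fst g); [exact: continuous_fst|exact: cg].
by have [M HM] := bounded_bidisc r cG; exists M => z zr; exact: (HM z z).
Qed.

Lemma geometric_small (c e : R) : 0 <= c -> 0 < e -> exists n0,
  forall n, (n0 <= n)%N -> c / 2 ^+ n <= e.
Proof.
move=> c0 e0; exists (Num.bound (c / e)) => n n0n.
rewrite ler_pdivrMr ?exprn_gt0// mulrC -ler_pdivrMr//.
apply: le_trans (ltW (archi_boundP _)) _; first by rewrite divr_ge0// ltW.
by rewrite -natrX ler_nat (leq_trans n0n)// ltnW// ltn_expl.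
Qed.

Lemma tcoef0 g : (forall z, complex_diff_at g z) -> tcoef g 0 = g 0.
Proof.
move=> dg; have [M HM] := bounded_disc 1 (continuous_diff dg).
have := @taylor_remainder R g 0 1 M 0 dg ltr01 _ HM.
rewrite cabs0 mul0r divr_ge0// => /(_ isT); rewrite big_ord1 expr0 mulr1 expr1 mulr0.
by move=> H; apply/esym/cabs_le0_eq.
Qed.

(** Liouville's theorem for polynomial growth: Cauchy's estimates on large
    circles kill the Taylor coefficients of index above [k]. *)
Lemma poly_growth g (C : R) (k : nat) : (forall z, complex_diff_at g z) ->
  (forall z, 1 <= cabs z -> cabs (g z) <= C * cabs z ^+ k) ->
  exists2 q : {poly R[i]}, (size q <= k.+1)%N & forall z, g z = q.[z].
Proof.
move=> dg gC.
have C0 : 0 <= C.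
  by have := gC 1; rewrite cabs1 expr1n mulr1 lexx => /(_ isT); apply: le_trans;
    exact: cabs_ge0.
have cz m : (k < m)%N -> tcoef g m = 0.
  move=> km; apply: cabs_small_eq => e e0; rewrite subr0.
  pose r : R := 2 * C / e + 1.
  have r1 : 1 <= r by rewrite /r lerDr divr_ge0// ?mulr_ge0// ltW.
  have r0 : 0 < r by lra.
  have := @tcoef_le R g m r (C * r ^+ k) dg r0.
  have HM w : cabs w = r -> cabs (g w) <= C * r ^+ k.
    by move=> wr; rewrite -wr; apply: gC; rewrite wr.
  move=> /(_ HM) H; apply: le_trans H _.
  pose j := (m - k.+1)%N.
  have -> : r ^+ m = r ^+ k * r ^+ j.+1.
    by rewrite -exprD addnS -addSn subnKC.
  have -> : C * r ^+ k / (r ^+ k * r ^+ j.+1) = C / r ^+ j.+1.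
    by field; rewrite !expf_neq0// gt_eqF.
  apply: (@le_trans _ _ (2 * (C / r))).
    rewrite ler_pM2l// ler_wpM2l// lef_pV2 ?posrE ?exprn_gt0//.
    by rewrite exprS ler_peMr ?(ltW r0)// exprn_ege1.
  rewrite mulrA ler_pdivrMr// /r.
  have -> : e * (2 * C / e + 1) = 2 * C + e by field; rewrite gt_eqF.
  by lra.
exists (\poly_(i < k.+1) tcoef g i); first exact: size_poly.
move=> z; rewrite horner_poly; apply: cabs_small_eq => e e0.
pose r : R := 2 * cabs z + 1.
have z0 := cabs_ge0 z.
have r0 : 0 < r by rewrite /r; lra.
have [M HM] := bounded_disc r (continuous_diff dg).
have M0 : 0 <= M by apply: le_trans (cabs_ge0 (g 0)) (HM 0 _); rewrite cabs0 ltW.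
have zr : cabs z <= r / 2 by rewrite /r; lra.
have M80 : 0 <= 8 * M by lra.
have [n0 Hn] := geometric_small M80 e0.
pose n := (n0 + k)%N.
have := @taylor_remainder R g z r M n dg r0 zr HM.
have -> : \sum_(i < n.+1) tcoef g i * z ^+ i = \sum_(i < k.+1) tcoef g i * z ^+ i.
  rewrite [RHS](big_ord_widen n.+1 (fun i => tcoef g i * z ^+ i)) ?ltnS ?leq_addl//.
  rewrite [LHS](bigID (fun i : 'I_n.+1 => (i < k.+1)%N)) /= [X in _ + X]big1 ?addr0//
    => i.
  by rewrite -leqNgt => ki; rewrite cz// mul0r.
move=> H; apply: le_trans H _; apply: le_trans (Hn n.+1 _); last first.
  by rewrite /n (leq_trans (leq_addr k n0)).
rewrite ler_wpM2l// -exprVn lerXn2r ?nnegrE ?divr_ge0 ?(ltW r0)//.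
by rewrite ler_pdivrMr//; lra.
Qed.

(** Differentiation under the circle mean: the second order Taylor remainder
    is uniform over the circle. *)
Lemma cmean_param_diff (G : R[i] * R[i] -> R[i]) k : continuous G ->
  (forall s t, complex_diff_at (fun t => G (s, t)) t) ->
  forall t, complex_diff_at (fun t => tcoef (fun s => G (s, t)) k) t.
Proof.
move=> cG dG t0.
have cT : continuous (fun w : R[i] => t0 + w).
  by move=> w; apply: (@continuousC_D _ _ (fun=> t0) id w);
    [exact: cst_continuous|exact: cvg_id].
have cG' : continuous (fun q : R[i] * R[i] => G (q.1, t0 + q.2)).
  apply: (@continuous_compo _ _ _ (fun q : R[i] * R[i] => (q.1, t0 + q.2)) G);
    last exact: cG.
  apply: (@continuous_pair _ _ _ fst (fun q : R[i] * R[i] => t0 + q.2)).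
    exact: continuous_fst.
  apply: (@continuous_compo _ _ _ snd (fun w : R[i] => t0 + w)); last exact: cT.
  exact: continuous_snd.
have [M HM] := bounded_bidisc 1 cG'.
have M0 : 0 <= M.
  by apply: le_trans (cabs_ge0 _) (HM 0 0 _ _); rewrite cabs0.
pose c1 s := tcoef (fun w => G (s, t0 + w)) 1.
have dGs s w : complex_diff_at (fun w => G (s, t0 + w)) w.
  apply: (@cdiff_comp _ (fun t => G (s, t)) (fun w => t0 + w)); last exact: dG.
  by apply: cdiffD; [exact: cdiff_cst|exact: cdiff_id].
have rem s w : cabs s = 1 -> cabs w <= 1 / 2 ->
    cabs (G (s, t0 + w) - G (s, t0) - c1 s * w) <= 8 * M * cabs w ^+ 2.
  move=> s1 w1.
  have := @taylor_remainder R (fun w => G (s, t0 + w)) w 1 M 1 (dGs s) ltr01 w1.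
  have HMs v : cabs v <= 1 -> cabs (G (s, t0 + v)) <= M.
    by move=> v1; apply: (HM s v) => //; rewrite s1.
  move=> /(_ HMs); rewrite divr1 big_ord_recl big_ord1 /= tcoef0// expr0 mulr1 expr1
    addr0.
  by rewrite opprD addrA.
pose cr : R -> R[i] := @ucirc R.
have ccr : continuous cr by exact: continuous_ucirc.
have cinv (n : nat) : continuous (fun y => (cr y)^-1 ^+ n).
  apply: continuous_Xn => y; apply: (@continuousC_V _ _ cr); last exact: ccr.
  exact: ucirc_neq0.
have cc1 : continuous (fun y => c1 (cr y)).
  apply: continuousC_Z.
  pose K (q : R * R) := G (cr q.1, t0 + cr q.2) * (cr q.2)^-1 ^+ 1.
  have cfst := @continuous_fst R R.
  have csnd := @continuous_snd R R.
  have cK : continuous K.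
    move=> q; apply: (@continuousC_M _ _ (fun q : R * R => G (cr q.1, t0 + cr q.2))
      (fun q : R * R => (cr q.2)^-1 ^+ 1)).
      apply: (@continuous_compo _ _ _ (fun q : R * R => (cr q.1, t0 + cr q.2)) G);
        last exact: cG.
      apply: (@continuous_pair _ _ _ (fun q : R * R => cr q.1) (fun q : R * R => t0 +
        cr q.2)).
        exact: (continuous_compo cfst ccr).
      exact: (continuous_compo (continuous_compo csnd ccr) cT).
    exact: (@continuous_compo _ _ _ snd (fun y => (cr y)^-1 ^+ 1) csnd (cinv 1%N)).
  exact: (cint_param_continuous (ltW (pi2_gt0 R)) cK).
have cGt t : continuous (fun y => G (cr y, t)).
  apply: (@continuous_compo _ _ _ (fun y => (cr y, t)) G); last exact: cG.
  apply: (@continuous_pair _ _ _ cr (fun=> t)); [exact: ccr|exact: cst_continuous].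
have cGk t : continuous (fun y => G (cr y, t) * (cr y)^-1 ^+ k).
  by move=> y; apply: (@continuousC_M _ _ (fun y => G (cr y, t)) (fun y => (cr y)^-1 ^+
    k));
    [exact: cGt|exact: cinv].
have cck : continuous (fun y => c1 (cr y) * (cr y)^-1 ^+ k).
  by move=> y; apply: (@continuousC_M _ _ (fun y => c1 (cr y)) (fun y => (cr y)^-1 ^+ k));
    [exact: cc1|exact: cinv].
exists (tcoef c1 k) => e e0.
pose r := Num.min (1 / 2) (e / (16 * M + 1)).
have r0 : 0 < r by rewrite /r lt_min !divr_gt0//; lra.
exists r => // t tr.
pose w := t - t0.
have -> : t = t0 + w by rewrite /w addrC subrK.
have wr : cabs w < r by [].
rewrite [t0 + w]addrC addrK.
have cB : continuous (fun y => G (cr y, w + t0) * (cr y)^-1 ^+ k - G (cr y, t0) * (cr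
  y)^-1 ^+ k).
  by move=> y; apply: (@continuousC_D _ _ (fun y => G (cr y, w + t0) * (cr y)^-1 ^+ k));
    [exact: cGk|apply: continuousC_N; exact: cGk].
have cZ := @continuousC_Z R _ w cck.
have cE : continuous (fun y => G (cr y, w + t0) * (cr y)^-1 ^+ k - G (cr y, t0) * (cr
  y)^-1 ^+ k
   - w * (c1 (cr y) * (cr y)^-1 ^+ k)).
  by move=> y; apply: (@continuousC_D _ _ (fun y => G (cr y, w + t0) * (cr y)^-1 ^+ k -
    G (cr y, t0) * (cr y)^-1 ^+ k));
    [exact: cB|apply: continuousC_N; exact: cZ].
have -> : tcoef (fun s => G (s, w + t0)) k - tcoef (fun s => G (s, t0)) k - tcoef c1 k
  * w =
  cmean (fun s => G (s, w + t0) * s^-1 ^+ k - G (s, t0) * s^-1 ^+ k - w * (c1 s * s^-1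
    ^+ k)).
  rewrite (@cmeanB R (fun s => G (s, w + t0) * s^-1 ^+ k - G (s, t0) * s^-1 ^+ k)
    (fun s => w * (c1 s * s^-1 ^+ k)) cB cZ).
  rewrite (@cmeanB R (fun s => G (s, w + t0) * s^-1 ^+ k) (fun s => G (s, t0) * s^-1 ^+ k)
    (cGk _) (cGk _)).
  by rewrite (@cmeanZ R (fun s => c1 s * s^-1 ^+ k) w cck) [w * _]mulrC.
have w0 := cabs_ge0 w.
have w12 : cabs w <= 1 / 2 by apply: ltW; apply: lt_le_trans wr _; rewrite /r ge_min lexx.
have we : cabs w * (16 * M + 1) <= e.
  rewrite -ler_pdivlMr; last by lra.
  by apply: ltW; apply: lt_le_trans wr _; rewrite /r ge_min lexx orbT.
apply: (@le_trans _ _ (2 * (8 * M * cabs w ^+ 2))).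
  apply: cabs_cmean_le; first exact: cE.
  move=> s s1.
  have -> : G (s, w + t0) * s^-1 ^+ k - G (s, t0) * s^-1 ^+ k - w * (c1 s * s^-1 ^+ k) =
     (G (s, t0 + w) - G (s, t0) - c1 s * w) * s^-1 ^+ k.
    by rewrite [w + t0]addrC; ring.
  by rewrite cabsM cabsX cabsV s1 invr1 expr1n mulr1; exact: rem.
rewrite expr2 !mulrA ler_wpM2r//; apply: le_trans we.
by rewrite mulrC; nra.
Qed.

Variables (d : nat) (F : 'rV[R[i]]_d -> R[i]).
Hypothesis hF : entire F.
Implicit Types (a b : 'rV[R[i]]_d).

(** The [k]-th homogeneous part of the Taylor expansion of [F] at 0, in
    direction [a]. *)
Definition hpart (k : nat) a : R[i] := tcoef (fun s => F (s *: a)) k.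

Lemma line_diff a b t : complex_diff_at (fun t => F (a + t *: b)) t.
Proof.
apply/complex_diffP; apply: (@differentiable_comp _ _ _ _ (fun t : R[i] => a + t *: b)
  F); last exact: hF.
apply: (@differentiableD _ _ _ (cst a) (fun t : R[i] => t *: b));
  first exact: differentiable_cst.
by apply: (@differentiableZl _ _ _ id); apply/complex_diffP; exact: cdiff_id.
Qed.

Lemma ray_diff a s : complex_diff_at (fun s => F (s *: a)) s.
Proof.
have -> : (fun s => F (s *: a)) = (fun s => F (0 + s *: a)).
  by apply/funext => t; rewrite add0r.
exact: line_diff.
Qed.

Lemma plane_continuous a b : continuous (fun q : R[i] * R[i] => F (q.1 *: a + q.2 *: b)).
Proof.
apply: (@continuous_compo _ _ _ (fun q : R[i] * R[i] => q.1 *: a + q.2 *: b) F).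
  move=> q; apply: (@cvgD _ _ _ (nbhs q) _ (fun q : R[i] * R[i] => q.1 *: a) (fun q :
    R[i] * R[i] => q.2 *: b)).
    by apply: (@cvgZr_tmp _ _ _ (nbhs q) _ (fun q : R[i] * R[i] => q.1));
      exact: continuous_fst.
  by apply: (@cvgZr_tmp _ _ _ (nbhs q) _ (fun q : R[i] * R[i] => q.2));
    exact: continuous_snd.
by move=> z; apply: differentiable_continuous; exact: hF.
Qed.

(** When [|t| = rho >= 1], Cauchy's estimate for [s |-> F (s (a + t b))] on the
    circle of radius [1 / rho] only involves [F] on a fixed bidisc of the plane
    of [a] and [b], so the growth in [t] is at most that of [rho ^ k]. *)
Lemma hpart_poly k a b : exists2 q : {poly R[i]}, (size q <= k.+1)%N &
  forall t, hpart k (a + t *: b) = q.[t].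
Proof.
have [M HM] := bounded_bidisc 1 (@plane_continuous a b).
have M0 : 0 <= M.
  by apply: le_trans (cabs_ge0 _) (HM 0 0 _ _); rewrite cabs0.
apply: (@poly_growth _ (2 * M)).
  pose G (q : R[i] * R[i]) := F (q.1 *: (a + q.2 *: b)).
  apply: (@cmean_param_diff G k).
    have -> : G = (fun q => F (q.1 *: a + (q.1 * q.2) *: b)).
      by apply/funext => q; rewrite /G scalerDr scalerA.
    apply: (@continuous_compo _ _ _ (fun q : R[i] * R[i] => (q.1, q.1 * q.2))
      (fun q : R[i] * R[i] => F (q.1 *: a + q.2 *: b))); last exact: plane_continuous.
    apply: (@continuous_pair _ _ _ fst (fun q : R[i] * R[i] => q.1 * q.2)).
      exact: continuous_fst.
    by move=> q; apply: (@continuousC_M _ _ fst snd);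
      [exact: continuous_fst|exact: continuous_snd].
  move=> s t.
  have -> : (fun t => G (s, t)) = (fun t => F (s *: a + t *: (s *: b))).
    by apply/funext => t'; rewrite /G /= scalerDr !scalerA mulrC.
  exact: line_diff.
move=> t t1; have t0 : 0 < cabs t by lra.
have := @tcoef_le R (fun s => F (s *: (a + t *: b))) k (cabs t)^-1 M (ray_diff _).
rewrite invr_gt0 exprVn invrK mulrA => /(_ t0); apply => w wt.
rewrite scalerDr scalerA; apply: (HM w (w * t)); first by rewrite wt invf_le1.
by rewrite cabsM wt mulVf// gt_eqF.
Qed.

Lemma hpart_scale k a (c : R) : 0 <= c -> hpart k (c%:C *: a) = c%:C ^+ k * hpart k a.
Proof.
rewrite le_eqVlt => /predU1P[<-|c0].
  rewrite rmorph0 scale0r /hpart expr0n.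
  have -> : (fun s => F (s *: 0)) = (fun=> F 0).
    by apply/funext => s; rewrite scaler0.
  have -> : tcoef (fun=> F 0) k = F 0 * tcoef (fun=> 1) k.
    rewrite /tcoef -(@cmeanZ _ (fun w => 1 * w^-1 ^+ k) _ (@continuous_one_coef R k)).
    by apply: eq_cmean => w _; rewrite mulrA mulr1.
  rewrite tcoef1; case: k => [|k] /=; last by rewrite mulr0 mul0r.
  by rewrite mulr1 mul1r tcoef0 ?scale0r// => s; exact: ray_diff.
rewrite [in RHS]/hpart (tcoef_radius k (ray_diff a) c0) /hpart /tcoef.
have cc : c%:C != 0 by rewrite -cabs_gt0 cabs_real gtr0_norm.
rewrite -(@cmeanZ _ (fun w => F ((c%:C * w) *: a) * (c%:C * w)^-1 ^+ k)).
  apply: eq_cmean => w w1; have w0 : w != 0 by rewrite -cabs_gt0 w1.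
  rewrite scalerA [w * _]mulrC invfM exprMn mulrCA; congr (_ * _).
  by rewrite mulrA -exprMn mulfV// expr1n mul1r.
apply: (@continuous_coef_integrand R (fun s => F (s *: a))); first by rewrite gt_eqF.
by apply: continuous_diff => s; exact: ray_diff.
Qed.

(** Taylor's formula at the point 1 of the ray through [a]. *)
Lemma hpart_sum_le a (B : R) : (forall n, \sum_(k < n) cabs (hpart k a) <= B) ->
  cabs (F a) <= B.
Proof.
move=> HB; apply/ler_addgt0Pr => e e0.
have [M HM] := bounded_disc 2 (continuous_diff (ray_diff a)).
have M0 : 0 <= M by apply: le_trans (cabs_ge0 _) (HM 0 _); rewrite cabs0.
have M80 : 0 <= 8 * M by lra.
have [n Hn] := geometric_small M80 e0.
have := @taylor_remainder R (fun s => F (s *: a)) 1 2 M n (ray_diff a) (ltr0n _ 2).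
rewrite cabs1 divff// lexx => /(_ isT HM); rewrite scale1r mul1r exprVn.
move=> H; rewrite -(subrK (\sum_(k < n.+1) tcoef (fun s => F (s *: a)) k * 1 ^+ k) (F a)).
apply: le_trans (cabsD _ _) _; rewrite addrC; apply: lerD.
  apply: le_trans (HB n.+1); apply: le_trans (cabs_sum _ _ _) _.
  by apply: ler_sum => k _; rewrite expr1n mulr1.
by apply: le_trans H _; exact: Hn.
Qed.

Lemma hpart_le k a (r M : R) : 0 < r ->
  (forall s, cabs s = r -> cabs (F (s *: a)) <= M) ->
  cabs (hpart k a) <= 2 * (M / r ^+ k).
Proof. by move=> r0 HM; apply: tcoef_le => //; exact: ray_diff. Qed.

End HomogeneousExpansion.

(** * A Remez inequality for pointwise bounded families of polynomials *)

Section Remez.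
Variable R : realType.
Implicit Types (z w : R[i]) (x y : R).

Local Notation mu := (@lebesgue_measure R).

Lemma measurable_itv_cc x y : measurable (`[x, y]%classic : set R).
Proof. exact: measurable_itv. Qed.

Lemma mu_itv_cc x y : x <= y -> mu `[x, y] = (y - x)%:E.
Proof.
move=> xy; have := lebesgue_measure_itv `[x, y]; rewrite /= lte_fin => ->.
by move: xy; rewrite le_eqVlt => /predU1P[->|->//]; rewrite ltxx subrr.
Qed.

(** A set of measure more than 1/2 meets more than half of [4 (k+1)] equal
    cells; one point in every other of these gives separated points. *)
Lemma separated_points (E : set R) k : measurable E -> E `<=` `[0, 1] ->
  ((1 / 2)%:E < mu E)%E ->
  exists x : nat -> R, (forall i, (i <= k)%N -> E (x i)) /\
    forall i j, (i < j <= k)%N -> (j - i)%:R / (4 * k.+1)%:R <= x j - x i.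
Proof.
move=> mE E01 muE.
pose N := (4 * k.+1)%N.
have N0 : 0 < N%:R :> R by rewrite ltr0n.
pose cell (c : nat) : set R := `[c%:R / N%:R, c.+1%:R / N%:R]%classic.
pose hit (c : nat) : bool := `[< exists x, E x /\ cell c x >].
pose A (c : nat) : set R := if hit c then cell c else set0.
have cell_mu c : mu (cell c) = (N%:R^-1)%:E.
  rewrite mu_itv_cc.
    by congr EFin; rewrite -mulrBl -natrB ?subSnn ?mul1r.
  by rewrite ler_pM2r ?invr_gt0// ler_nat.
have mA c : measurable (A c) by rewrite /A; case: ifP => // _; exact: measurable_itv_cc.
have EA : E `<=` \big[setU/set0]_(c < N) A c.
  move=> x Ex; have /= := E01 x Ex; rewrite in_itv /= => /andP[x0 x1].
  have [c cN cx] : exists2 c, (c < N)%N & cell c x.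
    have xN0 : 0 <= x * N%:R by rewrite mulr_ge0// ltW.
    pose c := Num.truncn (x * N%:R).
    have /andP[c1 c2] := truncn_itv xN0.
    have [cN|Nc] := ltnP c N.
      exists c => //; rewrite /cell /= in_itv /= ler_pdivrMr// c1 /=.
      by rewrite ler_pdivlMr// ltW.
    exists N.-1; first by rewrite /N; lia.
    have NE : N.-1.+1 = N by rewrite /N; lia.
    have x1' : x = 1.
      apply/eqP; rewrite eq_le x1 -(ler_pM2r N0) mul1r.
      by apply: le_trans c1; rewrite ler_nat.
    rewrite /cell /= in_itv /= NE x1' ler_pdivrMr// mul1r ler_nat divff ?gt_eqF//.
    by rewrite lexx andbT /N; lia.
  rewrite -bigcup_mkord; exists c => //; rewrite /A ifT//.
  by apply/asboolP; exists x.
pose S := [set c : 'I_N | hit c]%SET.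
have cardS : (2 * k.+1 < #|S|)%N.
  have := @content_subadditive _ _ _ mu E A N (fun c _ => mA c) mE EA.
  have -> : (\sum_(i < N) mu (A i) = (#|S|%:R / N%:R)%:E)%E.
    rewrite (bigID (fun c : 'I_N => hit c)) /= [X in (_ + X)%E]big1; last first.
      by move=> c /negbTE hc; rewrite /A hc measure0.
    rewrite adde0 (eq_bigr (fun=> (N%:R^-1)%:E)); last first.
      by move=> c hc; rewrite /A hc cell_mu.
    rewrite sumEFin big_const iter_addr_0 [in RHS]mulr_natl; congr EFin; congr (_ *+ _).
    by apply: eq_card => c; rewrite !inE.
  move=> H; have := lt_le_trans muE H; rewrite lte_fin ltr_pdivlMr//.
  have -> : 1 / 2 * N%:R = (2 * k.+1)%:R :> R.
    by rewrite /N !natrM; field.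
  by rewrite ltr_nat.
pose s := map val (enum S).
have ss : size s = #|S| by rewrite size_map cardE.
have srt : sorted ltn s.
  have := iota_ltn_sorted 0 N; rewrite -val_enum_ord => sI.
  rewrite /s {1}/enum_mem -enumT.
  apply: subseq_sorted sI; first exact: ltn_trans.
  by apply: map_subseq; exact: filter_subseq.
have nthS i : (i <= k)%N -> hit (nth 0%N s (2 * i)).
  move=> ik; have : nth 0%N s (2 * i) \in s by rewrite mem_nth// ss; lia.
  by move=> /mapP[c]; rewrite mem_enum inE => hc ->.
have nthlt i j : (i < j)%N -> (j < size s)%N -> (nth 0%N s i + (j - i) <= nth 0%N s j)%N.
  elim: j => // j IH; rewrite ltnS leq_eqVlt => /predU1P[->|ij] js.
    rewrite subSnn addn1.
    by move: srt => /(sortedP 0%N)/(_ j js).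
  move: srt => /(sortedP 0%N)/(_ j js) => H.
  by have := IH ij (ltnW js); rewrite /ltn /= in H; lia.
have /choice[f Hf] : forall i, exists x, (i <= k)%N -> E x /\ cell (nth 0%N s (2 * i)) x.
  move=> i; have [ik|ki] := leqP i k; last by exists 0.
  by have /asboolP[x xP] := nthS i ik; exists x.
exists f; split; first by move=> i ik; case: (Hf i ik).
move=> i j /andP[ij jk].
have [_] := Hf i (ltnW (leq_trans ij jk)); rewrite /cell /= in_itv /= => /andP[_ fi].
have [_] := Hf j jk; rewrite /cell /= in_itv /= => /andP[fj _].
have H : (nth 0%N s (2 * i) + (2 * j - 2 * i) <= nth 0%N s (2 * j))%N.
  by apply: nthlt; rewrite ?ss; lia.
apply: le_trans (lerB fj fi); rewrite -mulrBl ler_pM2r ?invr_gt0// lerBrDr -natrD ler_nat.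
by lia.
Qed.

Lemma prod_distn n i : (i < n)%N ->
  (\prod_(0 <= j < n | j != i) ((i - j) + (j - i)) = i`! * (n - i.+1)`!)%N.
Proof.
elim: n => // n IH; rewrite ltnS leq_eqVlt => /predU1P[->|ilt].
  rewrite subnn fact0 muln1 big_mkcond big_nat_recr //= eqxx muln1.
  rewrite -[RHS]mul1n {IH}.
  rewrite (eq_big_nat _ _ (F2 := fun j => (n - j)%N)); last first.
    by move=> j /andP[_ jn]; rewrite ltn_eqF//=; lia.
  by rewrite big_mkord -ffact_prod ffactnn mul1n.
rewrite big_mkcond big_nat_recr //= -big_mkcond /= IH// gtn_eqF//=.
have -> : (i - n + (n - i) = n - i)%N by lia.
by rewrite subSS -mulnA; congr (_ * _)%N;
  rewrite -[in RHS](subnSK ilt) factS mulnC subnSK.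
Qed.

(** Both sides are compared with ['C(2 k + 1, k) k!], a product of [k] factors
    larger than [k + 1]. *)
Lemma expn_le_fact k : (k.+1 ^ k <= k`! * 2 ^ (2 * k).+1)%N.
Proof.
have h1 : (k.+1 ^ k <= (2 * k).+1 ^_ k)%N.
  rewrite ffact_prod -{2}[k]card_ord -prod_nat_const; apply: leq_prod => i _.
  by have := ltn_ord i; lia.
apply: leq_trans h1 _; rewrite -bin_ffact mulnC leq_mul2l; apply/orP; right.
have kk : (k < (2 * k).+2)%N by lia.
have := expnDn 1 1 (2 * k).+1; rewrite addn1 => ->.
under eq_bigr do rewrite !exp1n !muln1.
by rewrite (bigD1 (Ordinal kk)) //= leq_addr.
Qed.

(** Lagrange interpolation. In the constant 64, a factor 2 bounds the
    distances from [z] to the nodes, a factor 4 comes from their separation, a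
    factor 2 from summing binomial coefficients and a factor 4 from comparing
    [(k + 1) ^ k] with [k!]. *)
Lemma lagrange_bound (q : {poly R[i]}) k (x : nat -> R) (M : R) z :
  (size q <= k.+1)%N -> cabs z <= 1 ->
  (forall i, (i <= k)%N -> 0 <= x i <= 1) ->
  (forall i j, (i < j <= k)%N -> (j - i)%:R / (4 * k.+1)%:R <= x j - x i) ->
  (forall i, (i <= k)%N -> cabs q.[(x i)%:C] <= M) ->
  cabs q.[z] <= 2 * 64 ^+ k * M.
Proof.
move=> sq z1 x01 sep qM.
pose N : R := (4 * k.+1)%:R.
have N0 : 0 < N by rewrite ltr0n.
have M0 : 0 <= M by apply: le_trans (qM 0%N _); rewrite ?cabs_ge0.
(* The interpolation basis is indexed by an injective sequence, so the nodes
   are continued outside [[0, 1]]. *)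
pose X (i : nat) : R[i] := if (i <= k)%N then (x i)%:C else i%:R%:C + 1.
have xlt i j : (i < j <= k)%N -> x i < x j.
  move=> ij; rewrite -subr_gt0; apply: lt_le_trans (sep _ _ ij).
  by rewrite divr_gt0// ltr0n subn_gt0; case/andP: ij.
have Xre i : X i = (if (i <= k)%N then x i else i%:R + 1)%:C.
  by rewrite /X; case: ifP => // _; rewrite rmorphD rmorph1.
have Xinj : injective X.
  have mono i j : (i < j)%N -> X i != X j.
    move=> ij; rewrite !Xre; apply/eqP => /complexI /eqP; apply/negP.
    have [jk|kj] := leqP j k; first by rewrite (leq_trans (ltnW ij) jk) lt_eqF// xlt// ij.
    have j0 : 0 < j%:R :> R by rewrite ltr0n; lia.
    case: ifP => ik; rewrite lt_eqF//; last by rewrite ltrD2r ltr_nat.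
    by have /andP[_ xi1] := x01 _ ik; apply: le_lt_trans xi1 _; rewrite ltrDr.
  move=> i j XX; apply/eqP; case: ltngtP => // [/mono|/mono]; by rewrite XX eqxx.
have D i j : (i <= k)%N -> (j <= k)%N ->
    ((i - j) + (j - i))%:R / N <= cabs (X i - X j).
  move=> ik jk; rewrite /X ik jk -rmorphB cabs_real.
  have [ij|ji|->] := ltngtP i j.
  - have := sep i j; rewrite ij jk => /(_ isT) H.
    rewrite distrC ger0_norm; last by rewrite subr_ge0 ltW// xlt// ij.
    by have -> : (i - j + (j - i) = j - i)%N by lia.
  - have := sep j i; rewrite ji ik => /(_ isT) H.
    rewrite ger0_norm; last by rewrite subr_ge0 ltW// xlt// ji.
    by have -> : (i - j + (j - i) = i - j)%N by lia.
  - by rewrite !subnn mul0r normr_ge0.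
have q1 (i : 'I_k.+1) : cabs ((tnth (lagrange k.+1 X) i) : {poly R[i]}).[z]
    <= (2 * N) ^+ k / (i`! * (k - i)`!)%:R.
  rewrite lagrangeE// hornerM hornerC !horner_prod cabsM cabsV !cabs_prod mulrC.
  have ik : (i <= k)%N by rewrite -ltnS.
  have card1 : #|(fun j : 'I_k.+1 => j != i)| = k.
    have := cardC1 i; rewrite card_ord /=; apply: etrans; exact: eq_card.
  have low : (i`! * (k - i)`!)%:R / N ^+ k <=
      \prod_(j < k.+1 | j != i) cabs ('X - (X j)%:P).[X i].
    have -> : (i`! * (k - i)`!)%:R / N ^+ k =
        \prod_(j < k.+1 | j != i) (((i - j) + (j - i))%:R / N).
      rewrite big_split /= prodr_const card1 exprVn; congr (_ * _).
      rewrite -natr_prod; congr _%:R.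
      by rewrite -subSS -prod_distn// big_mkord.
    apply: ler_prod => j _; rewrite hornerXsubC D ?andbT//; last by rewrite -ltnS.
    by rewrite divr_ge0// ltW.
  have up : \prod_(j < k.+1 | j != i) cabs ('X - (X j)%:P).[z] <= 2 ^+ k.
    rewrite -[X in 2 ^+ X]card1 -prodr_const; apply: ler_prod => j _.
    rewrite cabs_ge0 hornerXsubC; apply: le_trans (cabsD _ _) _.
    have jk : (j <= k)%N by rewrite -ltnS.
    rewrite cabsN /X jk cabs_real; have /andP[a b] := x01 j jk.
    by rewrite ger0_norm//; lra.
  have f0 : 0 < (i`! * (k - i)`!)%:R :> R by rewrite ltr0n muln_gt0 !fact_gt0.
  have Nk : 0 < N ^+ k by rewrite exprn_gt0.
  apply: (@le_trans _ _ (2 ^+ k * ((i`! * (k - i)`!)%:R / N ^+ k)^-1)).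
    apply: ler_pM => //; first by apply: prodr_ge0 => j _; exact: cabs_ge0.
      by rewrite invr_ge0; apply: prodr_ge0 => j _; exact: cabs_ge0.
    rewrite lef_pV2 ?posrE//; last by rewrite divr_gt0.
    by apply: lt_le_trans low; rewrite divr_gt0.
  by rewrite invf_div exprMn mulrA.
rewrite (lagrange_gen (ltn0Sn k) Xinj sq) horner_sum.
apply: le_trans (cabs_sum _ _ _) _.
apply: (@le_trans _ _ (\sum_(i < k.+1) M * ((2 * N) ^+ k / (i`! * (k - i)`!)%:R))).
  apply: ler_sum => i _; rewrite hornerM hornerC cabsM.
  have ik : (i <= k)%N by rewrite -ltnS.
  apply: ler_pM; rewrite ?cabs_ge0//.
  by have := qM i ik; rewrite /X ik.
rewrite -mulr_sumr mulrC ler_wpM2r//.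
have kf : 0 < k`!%:R :> R by rewrite ltr0n fact_gt0.
have -> : \sum_(i < k.+1) (2 * N) ^+ k / (i`! * (k - i)`!)%:R =
   (2 * N) ^+ k * 2 ^+ k / k`!%:R.
  have -> : 2 ^+ k = (\sum_(i < k.+1) 'C(k, i))%:R :> R.
    rewrite -natrX; congr _%:R; have := expnDn 1 1 k; rewrite addn1 => ->.
    by apply: eq_bigr => i _; rewrite !exp1n !muln1.
  rewrite natr_sum mulr_sumr mulr_suml; apply: eq_bigr => i _.
  have ik : (i <= k)%N by rewrite -ltnS.
  have f0 : (i`! * (k - i)`!)%:R != 0 :> R by rewrite pnatr_eq0 -lt0n muln_gt0 !fact_gt0.
  have := bin_fact ik; set f := (i`! * (k - i)`!)%N in f0 * => <-.
  rewrite natrM invfM -mulrA; congr (_ * _).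
  by rewrite mulrA mulfV ?mul1r// pnatr_eq0 -lt0n bin_gt0.
rewrite ler_pdivrMr//.
have -> : (2 * N) ^+ k * 2 ^+ k = 16 ^+ k * (k.+1 ^ k)%:R.
  by rewrite /N natrM -exprMn natrX -exprMn; congr (_ ^+ _); ring.
have := expn_le_fact k; rewrite -(ler_nat R) => H.
apply: le_trans (ler_wpM2l (exprn_ge0 _ (ler0n R 16)) H) _.
rewrite natrM natrX exprS exprM.
have -> : 64 ^+ k = 16 ^+ k * (2 ^+ 2) ^+ k :> R.
  by rewrite -exprMn; congr (_ ^+ _); ring.
by rewrite le_eqVlt; apply/orP; left; apply/eqP; ring.
Qed.

Lemma cdiff_horner (q : {poly R[i]}) z : complex_diff_at (fun z => q.[z]) z.
Proof.
elim/poly_ind: q => [|q c IH].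
  rewrite (_ : (fun z => _) = fun=> 0); first exact: cdiff_cst.
  by apply/funext => w; rewrite horner0.
rewrite (_ : (fun z => _) = fun z => q.[z] * z + c); last first.
  by apply/funext => w; rewrite hornerMXaddC.
apply: cdiffD; last exact: cdiff_cst.
by apply: cdiffM; [exact: IH|exact: cdiff_id].
Qed.

(** The closed sets where the [n]-th bound holds increase to [[0, 1]], so one
    of them has measure above 1/2, and interpolation at its points gives the
    disc. Baire's theorem would only provide some interval on which a bound
    holds, and the geometric factor would depend on that interval, hence on
    the family; with measure the factor is universal. *)
Lemma pointwise_bound_poly (T : Type) (deg : T -> nat) (q : T -> {poly R[i]})
    (W : nat -> T -> R) :
  (forall t, (size (q t) <= (deg t).+1)%N) ->
  (forall t n m, (n <= m)%N -> W n t <= W m t) ->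
  (forall x, 0 <= x <= 1 -> exists n, forall t, cabs (q t).[x%:C] <= W n t) ->
  exists n, forall t z, cabs z <= 1 -> cabs (q t).[z] <= 2 * 64 ^+ deg t * W n t.
Proof.
move=> sq Wmono Hpt.
pose E (n : nat) : set R := `[0, 1]%classic `&`
  \bigcap_(t in setT) [set x | cabs (q t).[x%:C] <= W n t].
have cE n : closed (E n).
  apply: closedI; first exact: interval_closed.
  apply: closed_bigI => t _.
  rewrite (_ : [set x | _] = (fun x : R => cabs (q t).[x%:C]) @^-1` [set y | y <= W n
    t])//.
  apply: preimage_closed; last exact: closed_le.
  move=> x _.
  apply: (@continuous_comp _ _ _ (fun x : R => (q t).[x%:C]) (@cabs R));
    last exact: continuous_cabs.
  apply: (@continuous_comp _ _ _ (real_complex R) (fun z => (q t).[z]));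
    first exact: continuous_real_complex.
  exact: (continuous_diff (@cdiff_horner (q t))).
have mE n : measurable (E n) by exact: closed_measurable.
have UE : \bigcup_n E n = `[0, 1]%classic.
  apply/seteqP; split; first by move=> x [n _ []].
  move=> x x01; have := x01; rewrite /= in_itv /= => /Hpt[n Hn].
  by exists n => //; split=> [|t _]; [exact: x01|exact: Hn].
have ndE : nondecreasing_seq E.
  move=> n m nm; apply/subsetPset => x [x01 Hx]; split => // t _.
  by apply: le_trans (Wmono t n m nm); exact: Hx.
have mUE : measurable (\bigcup_n E n) by rewrite UE; exact: measurable_itv_cc.
have m01 : mu (\bigcup_n E n) = 1%:E.
  by rewrite UE mu_itv_cc ?ler01// subr0.
have cvgE : mu \o E @ \oo --> (1%:E : \bar R).
  by rewrite -m01; exact: nondecreasing_cvg_mu.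
have [n Hn] : exists n, ((1 / 2)%:E < mu (E n))%E.
  apply: contrapT => /forallNP H.
  have : ((1%:E : \bar R) <= (1 / 2)%:E)%E.
    apply: (cvge_le _ cvgE); apply: nearW => n /=.
    by rewrite leNgt; apply/negP; exact: H.
  by rewrite lee_fin; lra.
exists n => t z z1.
have E01 : E n `<=` `[0, 1]%classic by move=> x [].
have [x [xE sep]] := separated_points (deg t) (mE n) E01 Hn.
apply: (@lagrange_bound _ (deg t) x) => //.
  by move=> i ik; have /E01 := xE i ik; rewrite /= in_itv.
by move=> i ik; have [_] := xE i ik; exact.
Qed.

End Remez.

(** * From real lines to the whole space *)

Section Growth.
Variable R : realType.
Implicit Types (z w : R[i]) (x y : R).

(** Real bounds on the cube become bounds on the polydisc, one coordinate at
    a time: the coordinates already freed are part of the index of the family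
    to which the one-variable statement is applied. *)
Lemma cube_to_polydisc (d : nat) (P : nat -> 'rV[R[i]]_d -> R[i])
    (T0 : Type) (W : nat -> nat -> T0 -> R) :
  (forall k a b, exists2 q : {poly R[i]}, (size q <= k.+1)%N &
    forall t, P k (a + t *: b) = q.[t]) ->
  (forall k r n m, (n <= m)%N -> W n k r <= W m k r) ->
  (forall v : 'rV[R]_d, (forall j, 0 <= v ord0 j <= 1) ->
    exists n, forall k r, cabs (P k (map_mx (real_complex R) v)) <= W n k r) ->
  exists n, forall k r (z : 'rV[R[i]]_d), (forall j, cabs (z ord0 j) <= 1) ->
    cabs (P k z) <= (2 * 64 ^+ k) ^+ d * W n k r.
Proof.
move=> Ppoly Wmono Hreal.
suff S m : (m <= d)%N -> forall v : 'rV[R]_d, (forall j, 0 <= v ord0 j <= 1) ->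
    exists n, forall k r (z : 'rV[R[i]]_d),
    (forall j : 'I_d, (m <= j)%N -> z ord0 j = (v ord0 j)%:C) ->
    (forall j : 'I_d, (j < m)%N -> cabs (z ord0 j) <= 1) ->
    cabs (P k z) <= (2 * 64 ^+ k) ^+ m * W n k r.
  have [|n Hn] := S d (leqnn d) 0; first by move=> j; rewrite mxE lexx ler01.
  exists n => k r z z1; apply: Hn => j; last by rewrite z1.
  by rewrite leqNgt ltn_ord.
elim: m => [_|m IH md] v v01.
  have [n Hn] := Hreal v v01; exists n => k r z zv _.
  rewrite expr0 mul1r (_ : z = map_mx (real_complex R) v)//.
  by apply/rowP => j; rewrite zv// mxE.
pose jm := Ordinal md.
pose e : 'rV[R[i]]_d := delta_mx ord0 jm.
pose ok (p : nat * T0 * 'rV[R[i]]_d) := p.2 ord0 jm = 0 /\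
  (forall j : 'I_d, (m < j)%N -> p.2 ord0 j = (v ord0 j)%:C) /\
  (forall j : 'I_d, (j < m)%N -> cabs (p.2 ord0 j) <= 1).
have /choice[q Hq] : forall t : {p | ok p}, exists q : {poly R[i]},
    (size q <= (sval t).1.1.+1)%N /\
    forall s, P (sval t).1.1 ((sval t).2 + s *: e) = q.[s].
  by move=> t; have [q sq qE] := Ppoly (sval t).1.1 (sval t).2 e; exists q.
pose W' n (t : {p | ok p}) :=
  (2 * 64 ^+ (sval t).1.1) ^+ m * W n (sval t).1.1 (sval t).1.2.
have pos k : 0 <= (2 * 64 ^+ k) ^+ m :> R.
  by rewrite exprn_ge0// mulr_ge0// exprn_ge0.
have eE (z : 'rV[R[i]]_d) s (j : 'I_d) :
    (z + s *: e) ord0 j = z ord0 j + (if j == jm then s else 0).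
  by rewrite !mxE eqxx /=; case: eqP => _; rewrite ?mulr1 ?mulr0.
have [n Hn] : exists n, forall t z, cabs z <= 1 ->
    cabs (q t).[z] <= 2 * 64 ^+ (sval t).1.1 * W' n t.
  apply: (@pointwise_bound_poly R _ (fun t => (sval t).1.1) q W').
  - by move=> t; case: (Hq t).
  - by move=> t n n' nn'; rewrite /W' ler_wpM2l// Wmono.
  - move=> x x01.
    pose v' : 'rV[R]_d := \row_j (if j == jm then x else v ord0 j).
    have [|n Hn] := IH (ltnW md) v'.
      by move=> j; rewrite mxE; case: ifP.
    exists n => -[[[k r] z] [/= z0 [zv z1]]].
    have [_ <-] := Hq (exist _ (k, r, z) (conj z0 (conj zv z1))).
    rewrite /W' /=; apply: Hn => j mj; rewrite eE; last first.
      have jn : j != jm by rewrite -val_eqE /= ltn_eqF.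
      by rewrite (negbTE jn) addr0 z1.
    rewrite mxE; case: eqP => [->|/eqP jjm]; first by rewrite z0 add0r.
    by rewrite addr0 zv// ltn_neqAle mj andbT; apply: contra jjm => /eqP mj';
      exact/eqP/val_inj.
exists n => k r z zv z1.
pose z' := z + (- z ord0 jm) *: e.
have okz : ok (k, r, z').
  split; first by rewrite /= eE eqxx subrr.
  split=> j mj /=; rewrite eE.
    have jn : j != jm by rewrite -val_eqE /= gtn_eqF.
    by rewrite (negbTE jn) addr0 zv.
  have jn : j != jm by rewrite -val_eqE /= ltn_eqF.
  by rewrite (negbTE jn) addr0 z1// ltnW.
have := Hn (exist _ _ okz) (z ord0 jm) (z1 jm (leqnn _)).
have [_ <-] := Hq (exist _ _ okz).
by rewrite /W' /= /z' -addrA -scalerDl addNr scale0r addr0 exprS mulrA.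
Qed.

Lemma geometric_sum_le n : \sum_(k < n) (2^-1 : R) ^+ k <= 2.
Proof.
suff -> : \sum_(k < n) (2^-1 : R) ^+ k = 2 - 2 * 2^-1 ^+ n.
  by rewrite gerBl mulr_ge0// exprn_ge0// invr_ge0.
elim: n => [|n IH]; first by rewrite big_ord0 expr0 mulr1 subrr.
by rewrite big_ord_recr /= IH exprS; field.
Qed.

Lemma euclidean_norm_coord d (z : 'rV[R[i]]_d) j : cabs (z ord0 j) <= euclidean_norm z.
Proof.
rewrite /euclidean_norm -[leLHS]ger0_norm ?cabs_ge0// -sqrtr_sqr ler_wsqrtr//.
by rewrite (bigD1 j)//= lerDl sumr_ge0// => i _; rewrite sqr_ge0.
Qed.

Lemma euclidean_normZ d s (z : 'rV[R[i]]_d) :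
  euclidean_norm (s *: z) = cabs s * euclidean_norm z.
Proof.
rewrite /euclidean_norm -[X in X * _]ger0_norm ?cabs_ge0// -sqrtr_sqr -sqrtrM ?sqr_ge0//.
congr (Num.sqrt _); rewrite mulr_sumr; apply: eq_bigr => j _.
by rewrite mxE cabsM exprMn.
Qed.

Lemma euclidean_norm_cline d (u : 'rV[R]_d) s : unit_sphere u ->
  euclidean_norm (cline u s) = cabs s.
Proof.
move=> u1; rewrite /cline euclidean_normZ -[RHS]mulr1; congr (_ * _).
rewrite -u1 /euclidean_norm; congr (Num.sqrt _); apply: eq_bigr => j _.
by rewrite mxE cabs_real real_normK ?num_real.
Qed.

Lemma polar_real d (v : 'rV[R]_d) : (0 < d)%N -> (forall j, 0 <= v ord0 j <= 1) ->
  exists c (u : 'rV[R]_d), [/\ 0 <= c, c <= d%:R, unit_sphere u & v = c *: u].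
Proof.
move=> d0 v01.
pose c := Num.sqrt (\sum_(j < d) v ord0 j ^+ 2).
have S0 : 0 <= \sum_(j < d) v ord0 j ^+ 2 by rewrite sumr_ge0// => j _; rewrite sqr_ge0.
have Sd : \sum_(j < d) v ord0 j ^+ 2 <= d%:R.
  rewrite -[X in _ <= X%:R]card_ord -sum1_card natr_sum ler_sum// => j _.
  by have /andP[a b] := v01 j; rewrite expr_le1.
have c0 : 0 <= c by rewrite sqrtr_ge0.
have cd : c <= d%:R.
  have d1 : 1 <= d%:R :> R by rewrite ler1n.
  rewrite -(ger0_norm (ler0n R d)) -sqrtr_sqr ler_wsqrtr//.
  by apply: le_trans Sd _; rewrite expr2 ler_peMl// ler0n.
have [cz|cn] := eqVneq c 0; last first.
  exists c, (c^-1 *: v); split => //; last by rewrite scalerA mulfV// scale1r.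
  rewrite /unit_sphere /=.
  have -> : \sum_(j < d) (c^-1 *: v) ord0 j ^+ 2 = c^-1 ^+ 2 * \sum_(j < d) v ord0 j ^+ 2.
    by rewrite mulr_sumr; apply: eq_bigr => j _; rewrite mxE exprMn.
  rewrite sqrtrM ?sqr_ge0// sqrtr_sqr ger0_norm ?invr_ge0//.
  by rewrite -/c mulVf.
exists 0, (delta_mx ord0 (Ordinal d0)); split => //.
  rewrite /unit_sphere /= (bigD1 (Ordinal d0))//= mxE !eqxx expr1n big1 ?addr0 ?sqrtr1//.
  by move=> j jn; rewrite mxE eqxx /= (negbTE jn) expr0n.
rewrite scale0r; apply/rowP => j; rewrite mxE; apply/eqP.
move: cz => /eqP; rewrite sqrtr_eq0 => Sle.
have /eqP : \sum_(j < d) v ord0 j ^+ 2 = 0 by apply/eqP; rewrite eq_le Sle.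
rewrite psumr_eq0; last by move=> i _; rewrite sqr_ge0.
by move=> /allP/(_ j (mem_index_enum j))/=; rewrite sqrf_eq0.
Qed.

(** Cauchy's estimates turn the bounds on the lines into bounds on the
    homogeneous parts at real points, for every radius; these extend to the
    polydisc with a factor [A ^ k], and taking the radius [2 A |z|] in the
    estimate at [z] makes the series of homogeneous parts geometric of ratio
    1/2. The dilation factor does not depend on [lam]. *)
Lemma growth_transfer (d : nat) (F : 'rV[R[i]]_d -> R[i]) (omega : R -> R)
    (lam : nat -> R) :
  (0 < d)%N -> entire F -> (forall t, 0 <= t -> 0 <= omega t) ->
  (forall n m, (n <= m)%N -> lam n <= lam m) ->
  (forall u : 'rV[R]_d, unit_sphere u -> exists n : nat, forall s,
    cabs (F (cline u s)) <= expR (n%:R + lam n * omega (cabs s))) ->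
  exists n : nat, forall z : 'rV[R[i]]_d, 0 < euclidean_norm z ->
    cabs (F z) <= (4 * 2 ^+ d) *
      expR (n%:R + lam n * omega (2 * 64 ^+ d * d%:R * euclidean_norm z)).
Proof.
move=> d0 hF om0 lmono Hline.
have d0R : 0 < d%:R :> R by rewrite ltr0n.
(* Radii are parametrised by their logarithm, so that any real is an index. *)
pose rad (r : R) := expR r.
pose G (n : nat) (r : R) := expR (n%:R + lam n * omega (rad r)).
pose W n (k : nat) (r : R) := 2 * d%:R ^+ k * (G n r / rad r ^+ k).
have rad0 r : 0 < rad r by exact: expR_gt0.
have [|||n Hn] := @cube_to_polydisc d (hpart F) R W.
- exact: hpart_poly.
- move=> k r n m nm; apply: ler_wpM2l.
    by rewrite mulr_ge0// exprn_ge0// ltW.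
  apply: ler_wpM2r; first by rewrite invr_ge0 exprn_ge0// ltW.
  rewrite /G ler_expR; apply: lerD; first by rewrite ler_nat.
  by apply: ler_wpM2r; [apply: om0; exact: ltW|exact: lmono].
- move=> v v01; have [c [u [c0 cd u1 ->]]] := polar_real d0 v01.
  have [n Hn] := Hline u u1; exists n => k r.
  rewrite (_ : map_mx _ _ = c%:C *: map_mx (real_complex R) u); last first.
    by apply/rowP => j; rewrite !mxE rmorphM.
  rewrite (hpart_scale hF k _ c0) cabsM cabsX cabs_real ger0_norm//.
  have H : cabs (hpart F k (map_mx (real_complex R) u)) <= 2 * (G n r / rad r ^+ k).
    apply: (hpart_le hF) => // s sr; have := Hn s; rewrite /cline /G sr; exact.
  have -> : W n k r = d%:R ^+ k * (2 * (G n r / rad r ^+ k)) by rewrite /W; ring.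
  apply: ler_pM => //; [exact: exprn_ge0|exact: cabs_ge0|].
  by apply: lerXn2r; rewrite ?nnegrE// ltW.
exists n => z z0.
set B := 2 * 64 ^+ d * d%:R; set rho := euclidean_norm z.
have B0 : 0 < B by rewrite !mulr_gt0// exprn_gt0.
pose r := ln (B * rho).
have rE : rad r = B * rho by rewrite /rad lnK// posrE mulr_gt0.
pose z' := rho%:C^-1 *: z.
have rC : rho%:C != 0 :> R[i] by rewrite -cabs_gt0 cabs_real gtr0_norm.
have zE : z = rho%:C *: z' by rewrite /z' scalerA mulfV// scale1r.
have z'1 j : cabs (z' ord0 j) <= 1.
  rewrite mxE cabsM cabsV cabs_real gtr0_norm// mulrC ler_pdivrMr// mul1r.
  exact: euclidean_norm_coord.
have part k : cabs (hpart F k z) <= 2 * 2 ^+ d * G n r * 2^-1 ^+ k.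
  rewrite zE (hpart_scale hF k _ (ltW z0)) cabsM cabsX cabs_real gtr0_norm//.
  apply: le_trans (ler_wpM2l (exprn_ge0 _ (ltW z0)) (Hn k r z' z'1)) _.
  rewrite /W rE /B le_eqVlt; apply/orP; left; apply/eqP.
  rewrite exprMn -exprM mulnC exprM !exprMn exprVn.
  move: (G n r) => g; rewrite -!exprM.
  field; rewrite !expf_neq0 ?gt_eqF//.
apply: (hpart_sum_le hF) => m.
apply: (@le_trans _ _ (\sum_(k < m) 2 * 2 ^+ d * G n r * 2^-1 ^+ k)).
  by apply: ler_sum => k _; exact: part.
rewrite -mulr_sumr.
have -> : 4 * 2 ^+ d * expR (n%:R + lam n * omega (B * rho)) = 2 * 2 ^+ d * G n r * 2.
  by rewrite /G rE; ring.
by rewrite ler_wpM2l ?geometric_sum_le// !mulr_ge0 ?exprn_ge0 ?expR_ge0.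
Qed.

(** The doubling condition iterated [log2 B] times. *)
Lemma weight_doubling (omega : R -> R) (B : R) : weight_function omega ->
  (fun t => omega (2 * t)) =O_ (pinfty_nbhs R) omega -> 0 < B ->
  exists L M, 0 <= L /\ forall t, M < t -> omega (B * t) <= L * omega t.
Proof.
move=> [om0 omono _] /eqOP[K [Kr HK]] B0.
have {HK} := HK (Num.max K 0 + 1); rewrite ltr_pwDr// ?le_max ?lexx// => /(_ isT).
set A := Num.max K 0 + 1 => -[M0 [_ HM0]].
have A0 : 0 <= A by rewrite /A addr_ge0// le_max lexx orbT.
have om (t : R) : 0 <= t -> 0 <= omega t by move=> t0; apply: om0; rewrite in_itv /= t0.
pose M := Num.max M0 0.
have step t : M < t -> omega (2 * t) <= A * omega t.
  rewrite gt_max => /andP[tM t0]; have := HM0 t tM.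
  by rewrite /= !ger0_norm ?om// ?mulr_ge0// ltW.
have iter m t : M < t -> omega (2 ^+ m * t) <= A ^+ m * omega t.
  move=> tM; have t0 : 0 < t by move: tM; rewrite gt_max => /andP[].
  elim: m => [|m IH]; first by rewrite !expr0 !mul1r.
  rewrite !exprS -!mulrA; apply: le_trans (step _ _) _.
    by apply: lt_le_trans tM _; rewrite ler_peMl ?(ltW t0)// exprn_ege1// ler1n.
  by rewrite ler_wpM2l.
have [m Hm] : exists m : nat, B <= 2 ^+ m.
  exists (Num.bound B); apply: le_trans (ltW (archi_boundP (ltW B0))) _.
  by rewrite -natrX ler_nat ltnW// ltn_expl.
exists (A ^+ m), M; split; first exact: exprn_ge0.
move=> t tM; have t0 : 0 < t by move: tM; rewrite gt_max => /andP[].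
apply: le_trans (iter m t tM); apply: omono.
- by rewrite in_itv /= andbT mulr_ge0// ltW.
- by rewrite in_itv /= andbT mulr_ge0 ?exprn_ge0// ltW.
- by apply: ler_wpM2r => //; exact: ltW.
Qed.

Lemma weight_large (omega : R -> R) (C : R) : weight_function omega ->
  exists M, 0 < M /\ forall t, M < t -> C < omega t.
Proof.
move=> [om0 omono nub].
have [t0 [t00 Ct0]] : exists t0, 0 <= t0 /\ C < omega t0.
  apply: contrapT => H; apply: nub; exists C => _ [t /= + <-].
  rewrite in_itv /= andbT => t0; rewrite leNgt; apply/negP => Ct.
  by apply: H; exists t.
exists (t0 + 1); split; first by rewrite ltr_wpDl.
move=> t tt; apply: lt_le_trans Ct0 _; apply: omono; rewrite ?in_itv /= ?andbT//; lra.
Qed.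

Lemma log_ratio_le (omega : R -> R) w r x : 0 < omega r ->
  (log_ratio omega w r <= x%:E)%E = (cabs w <= expR (x * omega r)).
Proof.
move=> o0; rewrite /log_ratio inver gt_eqF//.
have [->|w0] := eqVneq w 0.
  rewrite cabs0 /lne lexx expR_ge0 mulNyr gtr0_sg ?invr_gt0//.
  by rewrite mul1e leNye.
have a0 : 0 < cabs w by rewrite cabs_gt0.
rewrite lne_EFin// -EFinM lee_fin ler_pdivrMr//.
by rewrite -{2}(lnK a0) ler_expR.
Qed.

Lemma limsup_infinity_lt (T : choiceType) (X : filteredType T) (N : X -> R)
    (f : X -> \bar R) x :
  (limf_esup f (at_infinity N) < x%:E)%E ->
  exists M, forall p, M < N p -> (f p <= x%:E)%E.
Proof.
move=> /ereal_inf_lt[_ [V [M _ MV] <-] Vx]; exists M => z Mz.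
apply: le_trans (ltW Vx); apply: ereal_sup_ubound; exists z => //; exact: MV.
Qed.

Lemma limsup_infinity_le (T : choiceType) (X : filteredType T) (N : X -> R)
    (f : X -> \bar R) (x : \bar R) M :
  (forall p, M < N p -> (f p <= x)%E) -> (limf_esup f (at_infinity N) <= x)%E.
Proof.
move=> H; apply: (@le_trans _ _ (ereal_sup (f @` [set z | M < N z]))).
  by apply: ereal_inf_lbound; exists [set z | M < N z] => //; exists M.
by apply: ge_ereal_sup => _ [z Mz <-]; exact: H.
Qed.

Lemma limsup_line_le_full d (omega : R -> R) (F : 'rV[R[i]]_d -> R[i]) (u : 'rV[R]_d) :
  unit_sphere u -> (limsup_line omega F u <= limsup_full omega F)%E.
Proof.
move=> u1; apply: le_ereal_inf_tmp => _ [V [M _ MV] <-].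
apply: (@limsup_infinity_le _ _ _ _ _ M) => s Ms.
apply: ereal_sup_ubound; exists (cline u s); first by apply: MV;
  rewrite /= euclidean_norm_cline.
by rewrite euclidean_norm_cline.
Qed.

(** The limsup gives the bound far from 0; near 0, [F] is bounded on the line
    and a large [n] absorbs the bound. *)
Lemma line_bound d (omega : R -> R) (F : 'rV[R[i]]_d -> R[i]) (u : 'rV[R]_d) x :
  weight_function omega -> entire F -> 0 <= x ->
  (limsup_line omega F u < x%:E)%E ->
  exists n : nat, forall s, cabs (F (cline u s)) <= expR (n%:R + x * omega (cabs s)).
Proof.
move=> hw hF x0 /limsup_infinity_lt[M HM].
have [om0 _ _] := hw; have [M' [_ HM']] := weight_large 0 hw.
pose r := Num.max M M'.
have cF := continuous_diff (@ray_diff R d F hF (map_mx (real_complex R) u)).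
have [K HK] := bounded_disc r cF.
exists (Num.bound (Num.max K 0)) => s.
have n0 : Num.max K 0 < (Num.bound (Num.max K 0))%:R.
  by apply: archi_boundP; rewrite le_max lexx orbT.
have oms : 0 <= omega (cabs s) by apply: om0; rewrite in_itv /= cabs_ge0.
have [sr|rs] := leP (cabs s) r.
  apply: le_trans (HK s sr) _; apply: le_trans (expR_ge1Dx _).
  have : K <= Num.max K 0 by rewrite le_max lexx.
  have := mulr_ge0 x0 oms; lra.
move: rs; rewrite gt_max => /andP[Ms M's].
have := HM s Ms; rewrite log_ratio_le; last exact: HM'.
by move=> H; apply: le_trans H _; rewrite ler_expR lerDr.
Qed.

(** Common to both halves of the theorem. For a finite limsup, [lam n = n]
    since the slope varies with the line; for a zero one, [lam] is a small
    constant, and it matters that [L] is chosen before [lam]. *)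
Lemma limsup_full_le d (omega : R -> R) (F : 'rV[R[i]]_d -> R[i]) :
  (0 < d)%N -> weight_function omega ->
  (fun t => omega (2 * t)) =O_ (pinfty_nbhs R) omega -> entire F ->
  exists L, 0 <= L /\ forall (lam : nat -> R) e, 0 < e ->
    (forall n, 0 <= lam n) -> (forall n m, (n <= m)%N -> lam n <= lam m) ->
    (forall u : 'rV[R]_d, unit_sphere u -> exists n : nat, forall s,
      cabs (F (cline u s)) <= expR (n%:R + lam n * omega (cabs s))) ->
    exists n, (limsup_full omega F <= (lam n * L + e)%:E)%E.
Proof.
move=> d0 hw hdouble hF.
have [om0 _ _] := hw.
have om (t : R) : 0 <= t -> 0 <= omega t by move=> t0; apply: om0; rewrite in_itv /= t0.
set B := 2 * 64 ^+ d * d%:R : R.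
have B0 : 0 < B by rewrite !mulr_gt0 ?exprn_gt0// ltr0n.
have [L [M1 [L0 HL]]] := weight_doubling hw hdouble B0.
exists L; split => // lam e e0 lam0 lmono Hline.
have [n Hn] := growth_transfer d0 hF om lmono Hline.
exists n.
pose C := 4 * 2 ^+ d : R.
have C1 : 1 <= C.
  have := @exprn_ege1 R d 2 (ler1n R 2); rewrite /C; lra.
have C0 : 0 < C by lra.
pose D := ln C + n%:R.
have D0 : 0 <= D by rewrite addr_ge0 ?ln_ge0.
have [M2 [M20 HM2]] := weight_large (D / e) hw.
apply: (@limsup_infinity_le _ _ _ _ _ (Num.max M1 M2)) => z.
rewrite gt_max => /andP[zM1 zM2].
have z0 : 0 < euclidean_norm z by apply: lt_trans zM2.
have HD := HM2 _ zM2.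
have oz : 0 < omega (euclidean_norm z) by apply: le_lt_trans HD; rewrite divr_ge0// ltW.
rewrite log_ratio_le//; apply: le_trans (Hn z z0) _.
rewrite -/B -/C -{1}(lnK C0) -expRD ler_expR mulrDl addrA -/D addrC; apply: lerD.
  by rewrite -mulrA ler_wpM2l// HL.
by apply: ltW; rewrite mulrC -ltr_pdivrMr.
Qed.

End Growth.

Theorem proposition1p4 (R : realType) (d : nat) (hd : (1 <= d)%N)
    (omega : R -> R) (homega : weight_function omega)
    (hdouble : (fun t => omega (2 * t)) =O_ (pinfty_nbhs R)
                 omega)
    (hconvex : convex_function (E := R^o) setT
                 (fun t => omega (expR t)))
    (F : 'rV[R[i]]_d -> R[i]) (hF : entire F) :
  ((forall u : 'rV[R]_d, unit_sphere u ->
      (limsup_line omega F u < +oo)%E) ->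
    (limsup_full omega F < +oo)%E) /\
  ((forall u : 'rV[R]_d, unit_sphere u ->
      limsup_line omega F u = 0%E) ->
    limsup_full omega F = 0%E).
Proof.
have [L [L0 HL]] := limsup_full_le hd homega hdouble hF.
have [om0 _ _] := homega.
split=> Hline.
  have [||||n Hn] := HL (fun n => n%:R) 1.
  - exact: ltr01.
  - by move=> n; rewrite ler0n.
  - by move=> n m nm; rewrite ler_nat.
  - move=> u u1.
    have [m Hm] : exists m : nat, (limsup_line omega F u < m%:R%:E)%E.
      have := Hline u u1; case: (limsup_line omega F u) => [x _| |_] //.
        exists (Num.bound `|x|); rewrite lte_fin; apply: le_lt_trans (ler_norm x) _.
        exact: archi_boundP.
      by exists 0%N; rewrite ltNyr.
    have [n Hn] := line_bound homega hF (ler0n R m) Hm.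
    exists (maxn n m) => s; apply: le_trans (Hn s) _;
      rewrite ler_expR lerD ?ler_nat ?leq_maxl//.
    by rewrite ler_wpM2r ?ler_nat ?leq_maxr// om0// in_itv /= cabs_ge0.
  by apply: le_lt_trans Hn _; rewrite ltry.
apply/eqP; rewrite eq_le; apply/andP; split; last first.
  pose u : 'rV[R]_d := delta_mx ord0 (Ordinal hd).
  have u1 : unit_sphere u.
    rewrite /unit_sphere /= (bigD1 (Ordinal hd))//= mxE !eqxx expr1n big1 ?addr0
      ?sqrtr1//.
    by move=> j jn; rewrite mxE eqxx /= (negbTE jn) expr0n.
  by rewrite -(Hline u u1); exact: limsup_line_le_full.
apply/lee_addgt0Pr => e e0; rewrite add0e.
pose l := e / (2 * (L + 1)).
have l0 : 0 < l by rewrite divr_gt0// mulr_gt0//; lra.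
have [||||n Hn] := HL (fun=> l) (e / 2).
- by rewrite divr_gt0.
- by move=> _; exact: ltW.
- by [].
- move=> u u1; apply: (line_bound homega hF (ltW l0)).
  by rewrite (Hline u u1) lte_fin.
apply: le_trans Hn _; rewrite lee_fin.
have : l * L <= e / 2.
  rewrite /l invfM mulrA -mulrA ler_piMr//; first by rewrite divr_ge0// ltW.
  by rewrite mulrC ler_pdivrMr; lra.
lra.
Qed.
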